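(* For the unit hypercone $D^\circ=\{z\in\mathbf{C}^n: |z_1|+\cdots+|z_n|<1\}$, $$1-\sqrt[n]{\tfrac{2}{3}}<B_n(D^\circ)<\frac{0.446663}{n}.$$
   Context: Multi-indices $\alpha=(\alpha_1,\dots,\alpha_n)$ have non-negative integer entries and $z^\alpha=z_1^{\alpha_1}\cdots z_n^{\alpha_n}$. A complete $n$-circular (complete Reinhardt) domain is a nonempty open connected set $D\subset\mathbf{C}^n$ such that if $z\in D$ and $|w_j|\le|z_j|$ for $j=1,\dots,n$, then $w\in D$. For such a $D$ and $r>0$ put $D_r=r\cdot D=\{rz: z\in D\}$. $B_n(D)$ denotes the biggest number $r$ with the following property: if a power series $\sum_\alpha c_\alpha z^\alpha$ converges in $D$ and satisfies $\left|\sum_\alpha c_\alpha z^\alpha\right|<1$ for all $z\in D$, then $$\sum_\alpha \sup_{z\in D_r}|c_\alpha z^\alpha|<1.$$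
   Formalization: The theorem is stated for n ≥ 2: for n = 1 the hypercone is the unit disc, where B_1 = 1/3 = 1 − 2/3 by Bohr's theorem, so the strict left inequality fails. *)

(* Defs.v *)
From HB Require Import structures.
From mathcomp Require Import all_boot all_order all_algebra.
From mathcomp Require Import complex finmap.
From mathcomp Require Import all_classical all_reals all_analysis.
From mathcomp.analysis Require Import showcase.summability.

Set Implicit Arguments.
Unset Strict Implicit.
Unset Printing Implicit Defensive.
Import Order.TTheory GRing.Theory Num.Theory.
Import numFieldNormedType.Exports.
Local Open Scope classical_set_scope.
Local Open Scope ring_scope.

(* The modulus of a complex number as an element of R; MathComp's own `|z|
   takes its values in R[i]. *)
Definition cmod (R : realType) (z : R[i]) : R := Normc.normc z.

Definition multiindex (n : nat) := {ffun 'I_n -> nat}.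

Definition monomial (R : realType) (n : nat) (z : 'rV[R[i]]_n)
  (a : multiindex n) : R[i] := \prod_(j < n) z 0 j ^+ a j.

(* The type R[i]^o carries the normed topology of the complex plane. *)
Definition ps_term (R : realType) (n : nat) (c : multiindex n -> R[i])
  (z : 'rV[R[i]]_n) (a : multiindex n) : R[i]^o := c a * monomial z a.

(* Multi-indices have no preferred enumeration: convergence is that of the net
   of partial sums over all finite sets of multi-indices, i.e. unconditional
   (equivalently, absolute) convergence. *)
Definition ps_cvg (R : realType) (n : nat) (c : multiindex n -> R[i])
  (z : 'rV[R[i]]_n) : Prop := cvg (partial_sum (ps_term c z) @ totally).

(* The limit of the same net; meaningful only when ps_cvg c z holds. *)
Definition ps_sum (R : realType) (n : nat) (c : multiindex n -> R[i])
  (z : 'rV[R[i]]_n) : R[i]^o := sum (ps_term c z).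

Definition dilate (R : realType) (n : nat) (r : R) (D : set 'rV[R[i]]_n) :
  set 'rV[R[i]]_n := [set real_complex R r *: z | z in D].

(* The suprema and their sum are taken in the extended reals, so that the
   strict inequality includes their finiteness. *)
Definition bohr_property (R : realType) (n : nat) (D : set 'rV[R[i]]_n)
  (r : R) : Prop :=
  forall c : multiindex n -> R[i],
    (forall z, D z -> ps_cvg c z) ->
    (forall z, D z -> cmod (ps_sum c z) < 1) ->
    (\esum_(a in [set: multiindex n])
       ereal_sup [set (cmod (ps_term c z a))%:E | z in dilate r D] < 1)%E.

(* B = B_n(D): the maximum (not merely the supremum) of the r > 0 having the
   above property. *)
Definition is_bohr_radius (R : realType) (n : nat) (D : set 'rV[R[i]]_n)
  (B : R) : Prop :=
  let S := [set r | 0 < r /\ bohr_property D r] in S B /\ ubound S B.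

Definition hypercone (R : realType) (n : nat) : set 'rV[R[i]]_n :=
  [set z | \sum_(j < n) cmod (z 0 j) < 1].

(* Main.v *)
Require Import Defs.
From HB Require Import structures.
From mathcomp Require Import all_boot all_order all_algebra.
From mathcomp Require Import complex finmap.
From mathcomp Require Import separable cyclic cyclotomic.
From mathcomp Require Import all_classical all_reals all_analysis.
From mathcomp.analysis Require Import showcase.summability.
From mathcomp Require Import ring lra zify.
Import Order.TTheory GRing.Theory Num.Theory.
Import numFieldNormedType.Exports.
Set Implicit Arguments.
Unset Strict Implicit.
Unset Printing Implicit Defensive.
Local Open Scope classical_set_scope.
Local Open Scope ring_scope.
Local Open Scope complex_scope.
Local Notation Re := complex.Re.
Local Notation Im := complex.Im.

(** The supremum of [|z^a|] over the hypercone is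
    [s_a = \prod_j (a_j / |a|) ^ a_j], so the sum in the Bohr property is
    [M(f, r) = \sum_a |c_a| s_a r^|a|].

    Lower bound.  If [|f| < 1] and [c_0 >= 0] then [1 - Re f > 0]; averaging this
    positive function against squares of trigonometric polynomials over tori of
    roots of unity gives [|c_a| s_a <= 2 (1 - c_0)] for [a <> 0], and a strictly
    better bound for the sum of the terms of exponents [(1,1)] and [(2,0)].  As
    [\sum_a r^|a| = (1 - r)^(-n)], [M(f, r) < 1] still holds slightly beyond
    [1 - (2/3)^(1/n)].

    Upper bound.  For [f = P (z_1 + .. + z_n)], with [P] a rescaled Taylor
    polynomial of [(x - w) / (1 - x w)] and [x] close to 1, the inequality
    [s_a >= |a|^(-|a|)] bounds [M(f, r)] below by
    [\sum_k |P_k| (r n / k)^k], which exceeds 1 because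
    [\sum_(1 <= k <= 5) (rho / k)^k > 1/2] for [rho = 0.446662].

    The supremum [B] of the admissible radii is admissible.  Suppose
    [M(f, B) = 1], [c_0 >= 0], and put [u = 1 - f].  If two exponents [b], [d] of
    [f] are not proportional then [s_(b+d) < s_b s_d], and this makes the
    majorant at [B] of [1 - (u + u^2 / 10) / 4], which is again bounded by 1 on
    the hypercone, exceed 1; that contradicts admissibility just below [B].
    Otherwise all exponents lie on a ray and [M(f, B) < 1] follows from
    [B < 1/3] as in one variable. *)

(** * The real-valued modulus on the complex numbers *)

Section Modulus.
Variable R : realType.
Implicit Types (x y : R) (z w : R[i]).

Lemma cmod_norm z : `|z| = (cmod z)%:C.
Proof. by rewrite /cmod normc_def; case: z. Qed.

Lemma cmod_ge0 z : 0 <= cmod z.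
Proof. by rewrite -ler0c -cmod_norm. Qed.

Lemma cmodM z w : cmod (z * w) = cmod z * cmod w.
Proof. exact: Normc.normcM. Qed.

Lemma cmodN z : cmod (- z) = cmod z.
Proof. by apply: complexI; rewrite -!cmod_norm normrN. Qed.

Lemma cmodV z : cmod z^-1 = (cmod z)^-1.
Proof. exact: Normc.normcV. Qed.

Lemma cmod0 : cmod (0 : R[i]) = 0.
Proof. exact: Normc.normc0. Qed.

Lemma cmod1 : cmod (1 : R[i]) = 1.
Proof. exact: Normc.normc1. Qed.

Lemma cmod_eq0 z : (cmod z == 0) = (z == 0).
Proof.
apply/eqP/eqP => [/Normc.eq0_normc//|->]; exact: cmod0.
Qed.

Lemma cmodX z k : cmod (z ^+ k) = cmod z ^+ k.
Proof. by elim: k => [|k IH]; rewrite ?expr0 ?cmod1// !exprS cmodM IH. Qed.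

Lemma cmod_prod (I : Type) (r : seq I) (F : I -> R[i]) :
  cmod (\prod_(i <- r) F i) = \prod_(i <- r) cmod (F i).
Proof. exact: (big_morph _ cmodM cmod1). Qed.

Lemma ler_cmodD z w : cmod (z + w) <= cmod z + cmod w.
Proof. by rewrite -lecR rmorphD /= -!cmod_norm ler_normD. Qed.

Lemma ler_cmod_sum (I : Type) (r : seq I) (P : pred I) (F : I -> R[i]) :
  cmod (\sum_(i <- r | P i) F i) <= \sum_(i <- r | P i) cmod (F i).
Proof.
elim/big_ind2 : _ => [|x1 y1 x2 y2 h1 h2|//]; first by rewrite cmod0.
by apply: (le_trans (ler_cmodD _ _)); apply: lerD.
Qed.

Lemma ler_cmodB z w : cmod z - cmod w <= cmod (z + w).
Proof.
by rewrite lerBlDr -[X in cmod X <= _](addrK w) -[cmod w]cmodN ler_cmodD.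
Qed.

Lemma cmod_real x : cmod x%:C = `|x|.
Proof. by rewrite /cmod /= expr0n /= addr0 sqrtr_sqr. Qed.

Lemma sqr_cmod z : cmod z ^+ 2 = Re z ^+ 2 + Im z ^+ 2.
Proof. by case: z => a b; rewrite /cmod /= sqr_sqrtr// addr_ge0 ?sqr_ge0. Qed.

Lemma mulcJ_cmod z : z * z^* = (cmod z ^+ 2)%:C.
Proof. by rewrite -sqr_normc cmod_norm rmorphXn. Qed.

Lemma ler_Re_cmod z : `|Re z| <= cmod z.
Proof. by rewrite -lecR -cmod_norm normc_ge_Re. Qed.

Lemma ler_Im_cmod z : `|Im z| <= cmod z.
Proof.
rewrite -(ler_pXn2r (_ : (0 < 2)%N)) ?nnegrE ?cmod_ge0//.
by rewrite real_normK ?num_real// sqr_cmod lerDr sqr_ge0.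
Qed.

Lemma Re_le_cmod z : Re z <= cmod z.
Proof. exact: le_trans (ler_norm _) (ler_Re_cmod _). Qed.

Lemma cmod_le_Re_Im z : cmod z <= `|Re z| + `|Im z|.
Proof.
rewrite -(ler_pXn2r (_ : (0 < 2)%N)) ?nnegrE ?cmod_ge0 ?addr_ge0//.
rewrite sqr_cmod sqrrD !real_normK ?num_real// lerD2r lerDl.
by rewrite mulrn_wge0// mulr_ge0.
Qed.

Lemma ReD z w : Re (z + w) = Re z + Re w.
Proof. by case: z w => [a b] [c d]. Qed.

Lemma ImD z w : Im (z + w) = Im z + Im w.
Proof. by case: z w => [a b] [c d]. Qed.

Lemma ReN z : Re (- z) = - Re z.
Proof. by case: z. Qed.

Lemma Re_sum (I : Type) (r : seq I) (P : pred I) (F : I -> R[i]) :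
  Re (\sum_(i <- r | P i) F i) = \sum_(i <- r | P i) Re (F i).
Proof. by apply: (big_morph (fun z : R[i] => Re z)) => // x y; exact: ReD. Qed.

Lemma Im_sum (I : Type) (r : seq I) (P : pred I) (F : I -> R[i]) :
  Im (\sum_(i <- r | P i) F i) = \sum_(i <- r | P i) Im (F i).
Proof. by apply: (big_morph (fun z : R[i] => Im z)) => // x y; exact: ImD. Qed.

Lemma Re_scale x z : Re (x%:C * z) = x * Re z.
Proof. by case: z => a b /=; rewrite mul0r subr0. Qed.

End Modulus.

(* Unconditional sums: nets of finite partial sums *)
#[local] Existing Instance totally_filter.

Section NetSum.
Variables (R : realType) (T : choiceType).
Implicit Types (a b : T -> R[i]) (s : R[i]) (F G : {fset T}).

(** Convergence of the net of finite partial sums, with a real [e] in place of a positive element of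
    [R[i]]; [cvg_net_sum] gives the equivalence. *)
Definition net_sum a s := forall e : R, 0 < e ->
  exists F0 : {fset T}, forall F, (F0 `<=` F)%fset ->
    cmod (\sum_(i <- F) a i - s) < e.

Lemma partial_sumE a F : partial_sum a F = \sum_(i <- F) a i.
Proof. by rewrite /partial_sum big_seq_fsetE. Qed.

Lemma cvg_net_sum (a : T -> R[i]^o) (s : R[i]^o) :
  partial_sum a @ totally --> s <-> net_sum a s.
Proof.
split=> [/cvgrPdist_lt h e e0|h].
  have := h e%:C; rewrite ltcR => /(_ e0)[F0 _ H]; exists F0 => F FF.
  by have := H F FF; rewrite /= distrC partial_sumE cmod_norm ltcR.
apply/cvgrPdist_lt => e e0.
have e_real : (Re e)%:C = e by apply/RRe_real/gtr0_real.
have [|F0 H] := h (Re e); first by rewrite -ltcR e_real.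
exists F0 => //= F FF.
by rewrite distrC partial_sumE cmod_norm -e_real ltcR H.
Qed.

Lemma net_sum_ps (a : T -> R[i]^o) :
  cvg (partial_sum a @ totally) -> net_sum a (sum a).
Proof. by move=> h; apply/cvg_net_sum. Qed.

Lemma ps_net_sum (a : T -> R[i]^o) s : net_sum a s ->
  cvg (partial_sum a @ totally) /\ sum a = s.
Proof.
move=> /cvg_net_sum h; split; first by apply/cvg_ex; exists s.
exact: cvg_lim h.
Qed.

Lemma net_sum_unique a s t : net_sum a s -> net_sum a t -> s = t.
Proof. by move=> /ps_net_sum[_ <-] /ps_net_sum[_ <-]. Qed.

Lemma big_fsubset (M : nmodType) (g : T -> M) F G : (F `<=` G)%fset ->
  \sum_(i <- G) g i = \sum_(i <- F) g i + \sum_(i <- (G `\` F)%fset) g i.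
Proof.
move=> FG; rewrite (big_fsetID _ (mem F)) /=; congr (_ + _).
  apply: eq_fbigl => i; rewrite !inE /= andbC.
  by case: (boolP (i \in F)) => //= /(fsubsetP FG).
by apply: eq_fbigl => i; rewrite !inE /= andbC.
Qed.

Lemma ler_sum_fsubset (g : T -> R) F G : (forall i, 0 <= g i) ->
  (F `<=` G)%fset -> \sum_(i <- F) g i <= \sum_(i <- G) g i.
Proof. by move=> g0 FG; rewrite (big_fsubset _ FG) lerDl sumr_ge0. Qed.

Lemma net_sum_ext a b s : a =1 b -> net_sum a s -> net_sum b s.
Proof. by move=> /funext ->. Qed.

Lemma net_sum_finite a G : (forall i, i \notin G -> a i = 0) ->
  net_sum a (\sum_(i <- G) a i).
Proof.
move=> a0 e e0; exists G => F GF.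
rewrite (big_fsubset _ GF) addrC addKr big_seq big1 ?cmod0// => i.
by rewrite !inE => /andP[/a0].
Qed.

Lemma net_sumD a b s t : net_sum a s -> net_sum b t ->
  net_sum (fun i => a i + b i) (s + t).
Proof.
move=> ha hb e e0.
have e2 : 0 < e / 2 by rewrite divr_gt0.
have [F1 h1] := ha _ e2; have [F2 h2] := hb _ e2.
exists (F1 `|` F2)%fset => F; rewrite fsubUset => /andP[/h1 l1 /h2 l2].
rewrite big_split /= opprD addrACA (le_lt_trans (ler_cmodD _ _))//.
by rewrite [e]splitr ltrD.
Qed.

Lemma net_sumZ a s k : net_sum a s -> net_sum (fun i => k * a i) (k * s).
Proof.
move=> ha e e0.
have k1 : 0 < cmod k + 1 by rewrite ltr_wpDl ?cmod_ge0.
have [|F0 h] := ha (e / (cmod k + 1)); first by rewrite divr_gt0.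
exists F0 => F /h; rewrite ltr_pdivlMr// => l.
rewrite -mulr_sumr -mulrBr cmodM (le_lt_trans _ l)// mulrC.
by rewrite ler_wpM2l ?cmod_ge0// lerDl.
Qed.

(** Splitting [F] by the sign of [g] leaves two sets still disjoint from [F0], and on each the sum
    of absolute values is, up to sign, the sum itself. *)
Lemma net_sum_real_bounded (g : T -> R) F0 (e : R) :
  (forall F, [disjoint F & F0]%fset -> `|\sum_(i <- F) g i| <= e) ->
  forall F, [disjoint F & F0]%fset -> \sum_(i <- F) `|g i| <= e + e.
Proof.
move=> h F FF0; rewrite (big_fsetID _ (fun i => 0 <= g i)) /=; apply: lerD.
  set G := [fset _ | _ in _ & _]%fset.
  have GF : (G `<=` F)%fset by apply/fsubsetP => i; rewrite !inE => /andP[].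
  have -> : \sum_(i <- G) `|g i| = \sum_(i <- G) g i.
    rewrite big_seq [RHS]big_seq; apply: eq_bigr => i.
    by rewrite !inE /= => /andP[_ gi]; rewrite ger0_norm.
  apply: le_trans (ler_norm _) (h _ _).
  exact: fdisjointWl GF FF0.
set G := [fset _ | _ in _ & _]%fset.
have GF : (G `<=` F)%fset by apply/fsubsetP => i; rewrite !inE => /andP[].
have -> : \sum_(i <- G) `|g i| = - \sum_(i <- G) g i.
  rewrite -sumrN big_seq [RHS]big_seq; apply: eq_bigr => i.
  by rewrite !inE /= -ltNge => /andP[_ gi]; rewrite ltr0_norm.
apply: le_trans (ler_norm _) _; rewrite normrN; apply: h.
exact: fdisjointWl GF FF0.
Qed.

(** Unconditional convergence implies absolute convergence. A sum over a set disjoint from [F0] is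
    the difference of two partial sums over supersets of [F0], hence at most [e / 4]; splitting by
    sign doubles this bound for the real parts and again for the imaginary parts. *)
Lemma net_sum_tail a s : net_sum a s -> forall e : R, 0 < e ->
  exists F0 : {fset T}, forall F, [disjoint F & F0]%fset ->
    \sum_(i <- F) cmod (a i) <= e.
Proof.
move=> h e e0; have e8 : 0 < e / 8 by rewrite divr_gt0.
have [F0 h0] := h _ e8; exists F0 => F FF0.
have H G : [disjoint G & F0]%fset -> cmod (\sum_(i <- G) a i) <= e / 4.
  move=> GF; have := h0 (G `|` F0)%fset (fsubsetUr _ _).
  have := h0 F0 (fsubset_refl _).
  have -> : \sum_(i <- (G `|` F0)%fset) a i
      = \sum_(i <- F0) a i + \sum_(i <- G) a i.
    rewrite (big_fsubset _ (fsubsetUr G F0)); congr (_ + _).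
    apply: eq_fbigl => i; rewrite !inE.
    case: (boolP (i \in F0)) => //= [iF|]; last by rewrite orbF.
    symmetry; apply/negbTE; move/fdisjointP: GF => /(_ i).
    by case: (i \in G) => // /(_ isT); rewrite iF.
  move=> l1 l2.
  have -> : \sum_(i <- G) a i = (\sum_(i <- F0) a i + \sum_(i <- G) a i - s)
      + - (\sum_(i <- F0) a i - s).
    by ring.
  apply: le_trans (ler_cmodD _ _) _; rewrite cmodN.
  have -> : e / 4 = e / 8 + e / 8 by field.
  by rewrite lerD// ltW.
have hR : \sum_(i <- F) `|Re (a i)| <= e / 4 + e / 4.
  apply: net_sum_real_bounded FF0 => G GF.
  by rewrite -Re_sum (le_trans (ler_Re_cmod _))// H.
have hI : \sum_(i <- F) `|Im (a i)| <= e / 4 + e / 4.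
  apply: net_sum_real_bounded FF0 => G GF.
  by rewrite -Im_sum (le_trans (ler_Im_cmod _))// H.
have -> : e = (e / 4 + e / 4) + (e / 4 + e / 4) by field.
apply: le_trans (lerD hR hI); rewrite -big_split /=.
by apply: ler_sum => i _; exact: cmod_le_Re_Im.
Qed.

Lemma net_sum_bounded a s : net_sum a s ->
  exists C : R, forall F, \sum_(i <- F) cmod (a i) <= C.
Proof.
move=> /net_sum_tail/(_ 1 ltr01)[F0 h].
exists (\sum_(i <- F0) cmod (a i) + 1) => F.
have a0 i : 0 <= cmod (a i) by exact: cmod_ge0.
apply: le_trans (ler_sum_fsubset a0 (fsubsetUl F F0)) _.
rewrite (big_fsubset _ (fsubsetUr F F0)) lerD2l h//.
by apply/fdisjointP => i; rewrite !inE => /andP[].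
Qed.

(** The set [F0] depends only on the dominating family [a], so a single truncation serves all
    rotations of a series at once. *)
Lemma net_sum_approx a b s t : (forall i, cmod (b i) <= cmod (a i)) ->
  net_sum a s -> net_sum b t -> forall e F0,
  (forall F, [disjoint F & F0]%fset -> \sum_(i <- F) cmod (a i) <= e) ->
  cmod (t - \sum_(i <- F0) b i) <= e.
Proof.
move=> ba ha hb e F0 h; apply/ler_addgt0Pr => d d0.
have [F1 h1] := hb _ d0.
have {}h1 := h1 (F0 `|` F1)%fset (fsubsetUr _ _).
move: h1; rewrite (big_fsubset _ (fsubsetUl F0 F1)).
set X := \sum_(i <- F0) b i; set Y := \sum_(i <- _) b i => l.
have -> : t - X = Y + - (X + Y - t) by ring.
apply: le_trans (ler_cmodD _ _) _; rewrite cmodN; apply: lerD (ltW l).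
apply: le_trans (ler_cmod_sum _ _ _) _.
apply: le_trans (ler_sum _ (fun i _ => ba i)) _; apply: h.
by apply/fdisjointP => i; rewrite !inE => /andP[].
Qed.

End NetSum.

(** * Multi-indices, degrees and boxes *)

Section Multiindex.
Variable n : nat.
Implicit Types (a b : multiindex n).

Definition mdeg a : nat := \sum_(j < n) a j.

Definition mi0 : multiindex n := [ffun => 0%N].

Definition madd a b : multiindex n := [ffun j => (a j + b j)%N].

Definition mord (N : nat) (k : {ffun 'I_n -> 'I_N}) : multiindex n :=
  [ffun j => nat_of_ord (k j)].

(** Boxes are cofinal among finite sets of exponents ([fsub_mbox]), and sums of products factor over
    them ([sum_mbox]). *)
Definition mbox (N : nat) : {fset multiindex n} :=
  [fset mord k | k in {: {ffun 'I_n -> 'I_N}}]%fset.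

Lemma in_mbox N a : (a \in mbox N) = [forall j, a j < N]%N.
Proof.
apply/imfsetP/forallP => [[k _ ->] j|h]; first by rewrite ffunE ltn_ord.
exists [ffun j => Ordinal (h j)] => //.
by apply/ffunP => j; rewrite !ffunE.
Qed.

Lemma mdeg_ge a j : (a j <= mdeg a)%N.
Proof. by rewrite /mdeg (bigD1 j)//= leq_addr. Qed.

Lemma mdeg_eq0 a : (mdeg a == 0)%N = (a == mi0).
Proof.
apply/eqP/eqP => [h|->]; last by rewrite /mdeg big1// => j _; rewrite ffunE.
by apply/ffunP => j; have := mdeg_ge a j; rewrite h leqn0 ffunE => /eqP.
Qed.

Lemma mdeg_gt0 a : (0 < mdeg a)%N = (a != mi0).
Proof. by rewrite lt0n mdeg_eq0. Qed.

Lemma mdeg0 : mdeg mi0 = 0%N.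
Proof. by apply/eqP; rewrite mdeg_eq0. Qed.

Lemma mdegD a b : mdeg (madd a b) = (mdeg a + mdeg b)%N.
Proof. by rewrite /mdeg -big_split; apply: eq_bigr => j _; rewrite ffunE. Qed.

Lemma maddC a b : madd a b = madd b a.
Proof. by apply/ffunP => j; rewrite !ffunE addnC. Qed.

Lemma madd0 a : madd a mi0 = a.
Proof. by apply/ffunP => j; rewrite !ffunE addn0. Qed.

Lemma madd0m a : madd mi0 a = a.
Proof. by rewrite maddC madd0. Qed.

Lemma maddI a : injective (madd a).
Proof.
by move=> b b' /ffunP h; apply/ffunP => j; have := h j; rewrite !ffunE => /addnI.
Qed.

Lemma mbox_mdeg N a : (mdeg a < N)%N -> a \in mbox N.
Proof.
by move=> h; rewrite in_mbox; apply/forallP => j; apply: leq_ltn_trans h;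
  exact: mdeg_ge.
Qed.

Lemma mbox_sub N N' : (N <= N')%N -> (mbox N `<=` mbox N')%fset.
Proof.
move=> h; apply/fsubsetP => a; rewrite !in_mbox => /forallP H.
by apply/forallP => j; apply: leq_trans h.
Qed.

Lemma fsub_mbox (F : {fset multiindex n}) : exists N, (F `<=` mbox N)%fset.
Proof.
exists (\max_(a <- F) mdeg a).+1; apply/fsubsetP => a aF.
by apply: mbox_mdeg; rewrite ltnS; exact: leq_bigmax_seq.
Qed.

Lemma sum_mbox (A : comPzSemiRingType) (g : 'I_n -> nat -> A) N :
  \sum_(a <- mbox N) \prod_(j < n) g j (a j)
  = \prod_(j < n) \sum_(k < N) g j k.
Proof.
rewrite bigA_distr_bigA /= big_imfset /=; last first.
  move=> k k' _ _ /ffunP h; apply/ffunP => j; apply: val_inj.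
  by have := h j; rewrite !ffunE.
by rewrite big_enum /=; apply: eq_bigr => k _; apply: eq_bigr => j _; rewrite ffunE.
Qed.

Lemma prod_pow_mdeg (A : comPzSemiRingType) (x : A) a :
  \prod_(j < n) x ^+ a j = x ^+ mdeg a.
Proof. by rewrite /mdeg prodr_const_seq_deprecated || rewrite prodrXr. Qed.

End Multiindex.

(** * The supremum of a monomial over the hypercone *)

Section MonomialSup.
Variables (R : realType) (n : nat).
Implicit Types (a b : multiindex n) (x : 'I_n -> R).

(* The supremum of [|z^a|] over the hypercone, approached at [a / |a|]; for
   [a = 0] the junk value [0 / 0 = 0] is harmless since it is raised to 0. *)
Definition msup a : R := \prod_(j < n) ((a j)%:R / (mdeg a)%:R) ^+ a j.

Lemma ltr_leM (x1 x2 y1 y2 : R) :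
  0 <= x1 -> x1 < x2 -> y1 <= y2 -> 0 < y2 -> x1 * y1 < x2 * y2.
Proof.
move=> x0 xx yy y0; apply: le_lt_trans (ler_wpM2l x0 yy) _.
by rewrite ltr_pM2r.
Qed.

Lemma msup_gt0 a : 0 < msup a.
Proof.
apply: prodr_gt0 => j _; case: (posnP (a j)) => [->|aj]; first by rewrite expr0.
rewrite exprn_gt0// divr_gt0 ?ltr0n//.
exact: leq_trans aj (mdeg_ge _ _).
Qed.

Lemma msup_ge0 a : 0 <= msup a.
Proof. exact: ltW (msup_gt0 a). Qed.

Lemma msup0 : msup (mi0 n) = 1.
Proof. by rewrite /msup big1// => j _; rewrite ffunE expr0. Qed.

(** With [u = k t / m] this is the [m]-th power of [u <= expR (u - 1)], where equality holds only at
    [u = 1]. *)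
Lemma ler_factor_expR (m k : nat) (t : R) : (m <= k)%N -> 0 <= t ->
  t ^+ m <= (m%:R / k%:R) ^+ m * expR (k%:R * t - m%:R)
  ?= iff (k%:R * t == m%:R).
Proof.
move=> mk t0; have [->|m0] := posnP m.
  rewrite !expr0 mul1r subr0; split.
    by rewrite -[leLHS]expR0 ler_expR mulr_ge0 ?ler0n.
  by rewrite -[X in X == _]expR0 (inj_eq (@expR_inj _)) [LHS]eq_sym.
have k0 : (0 < k)%N := leq_trans m0 mk.
have mR : (0 : R) < m%:R by rewrite ltr0n.
have kR : (0 : R) < k%:R by rewrite ltr0n.
have mN : m%:R != 0 :> R by rewrite gt_eqF.
have kN : k%:R != 0 :> R by rewrite gt_eqF.
pose u := k%:R * t / m%:R.
have -> : t = m%:R / k%:R * u.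
  by rewrite /u; field; rewrite mN kN.
have u0 : 0 <= u by rewrite /u divr_ge0 ?mulr_ge0 ?ler0n.
have -> : k%:R * (m%:R / k%:R * u) - m%:R = (u - 1) *+ m.
  by rewrite -mulr_natr; field.
have -> : (k%:R * (m%:R / k%:R * u) == m%:R) = (u == 1).
  have -> : k%:R * (m%:R / k%:R * u) = m%:R * u by field.
  by rewrite -[X in _ == X]mulr1 (inj_eq (mulfI mN)).
rewrite exprMn -[(u - 1) *+ m]mulr_natr expRM_natr.
have p0 : (0 : R) < (m%:R / k%:R) ^+ m by rewrite exprn_gt0// divr_gt0.
split.
  rewrite ler_pM2l// lerXn2r ?nnegrE ?expR_ge0//.
  by rewrite -[leLHS](subrK 1) addrC expR_ge1Dx.
rewrite (inj_eq (mulfI (lt0r_neq0 p0))).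
have [->|u1] := eqVneq u 1; first by rewrite subrr expR0 eqxx.
apply/negbTE; rewrite lt_eqF// ltrXn2r ?gtn_eqF//.
by rewrite -[ltLHS](subrK 1) addrC expR_gt1Dx// subr_eq0.
Qed.

(** Weighted AM-GM: in the product of the one-coordinate estimates the exponentials combine to
    [expR] of [|a| (\sum_j x j - 1) <= 0]. *)
Lemma prod_le_msup a x : (forall j, 0 <= x j) -> \sum_(j < n) x j <= 1 ->
  \prod_(j < n) x j ^+ a j <= msup a.
Proof.
move=> x0 x1.
apply: (@le_trans _ _ (\prod_(j < n) (((a j)%:R / (mdeg a)%:R) ^+ a j
    * expR ((mdeg a)%:R * x j - (a j)%:R)))).
  apply: ler_prod => j _; rewrite exprn_ge0//=.
  exact: (ler_factor_expR (mdeg_ge _ _) (x0 j)).1.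
rewrite big_split /= -expR_sum -[leRHS]mulr1 ler_wpM2l ?msup_ge0//.
rewrite -[leRHS]expR0 ler_expR sumrB -mulr_sumr -natr_sum subr_le0.
by rewrite -[leRHS]mulr1 ler_wpM2l.
Qed.

Lemma prod_lt_msup a x j : (forall j, 0 <= x j) -> \sum_(j < n) x j <= 1 ->
  (mdeg a)%:R * x j != (a j)%:R -> \prod_(j < n) x j ^+ a j < msup a.
Proof.
move=> x0 x1 xj.
apply: (@lt_le_trans _ _ (\prod_(j < n) (((a j)%:R / (mdeg a)%:R) ^+ a j
    * expR ((mdeg a)%:R * x j - (a j)%:R)))).
  rewrite (bigD1 j)//= [ltRHS](bigD1 j)//=.
  have lej i := ler_factor_expR (mdeg_ge a i) (x0 i).
  apply: ltr_leM => //.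
  - by rewrite exprn_ge0.
  - by rewrite lt_neqAle (lej j).2 (lej j).1 (negbTE xj).
  - by apply: ler_prod => i _; rewrite exprn_ge0//= (lej i).1.
  - apply: prodr_gt0 => i _; rewrite mulr_gt0 ?expR_gt0//.
    case: (posnP (a i)) => [->|ai]; first by rewrite expr0.
    by rewrite exprn_gt0// divr_gt0 ?ltr0n//; exact: leq_trans ai (mdeg_ge _ _).
rewrite big_split /= -expR_sum -[leRHS]mulr1 ler_wpM2l ?msup_ge0//.
rewrite -[leRHS]expR0 ler_expR sumrB -mulr_sumr -natr_sum subr_le0.
by rewrite -[leRHS]mulr1 ler_wpM2l.
Qed.

Lemma msupD a b : msup (madd a b)
  = \prod_(j < n) ((madd a b j)%:R / (mdeg (madd a b))%:R) ^+ a j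
    * \prod_(j < n) ((madd a b j)%:R / (mdeg (madd a b))%:R) ^+ b j.
Proof.
rewrite -big_split /=; apply: eq_bigr => j _.
by rewrite -exprD; congr (_ ^+ _); rewrite ffunE.
Qed.

Lemma sum_mdeg_ratio a : \sum_(j < n) ((a j)%:R / (mdeg a)%:R : R) <= 1.
Proof.
rewrite -mulr_suml -natr_sum -/(mdeg a).
by have [->|h] := posnP (mdeg a); rewrite ?mul0r// divff// pnatr_eq0 -lt0n.
Qed.

(** The extremal point [(a + b) / |a + b|] for [madd a b] is a competitor in the suprema for [a] and
    for [b]. If [a] and [b] are not proportional it is not extremal for [a], which makes [msupD_lt]
    strict. *)
Lemma msupD_le a b : msup (madd a b) <= msup a * msup b.
Proof.
rewrite msupD; apply: ler_pM; do ?by apply: prodr_ge0 => j _; rewrite exprn_ge0 ?divr_ge0.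
- by apply: prod_le_msup (sum_mdeg_ratio _) => j; rewrite divr_ge0.
- by apply: prod_le_msup (sum_mdeg_ratio _) => j; rewrite divr_ge0.
Qed.

Lemma msupD_lt a b j : a != mi0 n -> (b j * mdeg a != a j * mdeg b)%N ->
  msup (madd a b) < msup a * msup b.
Proof.
move=> a0 ab; rewrite msupD; apply: ltr_leM.
- by apply: prodr_ge0 => i _; rewrite exprn_ge0 ?divr_ge0.
- apply: (@prod_lt_msup _ _ j _ (sum_mdeg_ratio _)).
    by move=> i; rewrite divr_ge0.
  rewrite -mdeg_gt0 in a0.
  have dN : (mdeg (madd a b))%:R != 0 :> R.
    by rewrite pnatr_eq0 mdegD addn_eq0 negb_and -!lt0n a0.
  apply: contra ab; rewrite mulrA -(inj_eq (mulIf dN)) divfK// -!natrM eqr_nat.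
  by rewrite mdegD ffunE => /eqP h; apply/eqP; lia.
- by apply: prod_le_msup (sum_mdeg_ratio _) => i; rewrite divr_ge0.
- exact: msup_gt0.
Qed.

End MonomialSup.

(** * The majorant series and the Bohr property *)

Section Majorant.
Variables (R : realType) (n : nat).
Implicit Types (a b : multiindex n) (c : multiindex n -> R[i]) (z : 'rV[R[i]]_n).

Lemma cmod_monomial z a :
  cmod (monomial z a) = \prod_(j < n) cmod (z 0 j) ^+ a j.
Proof. by rewrite cmod_prod; apply: eq_bigr => j _; rewrite cmodX. Qed.

Lemma monomial0 z : monomial z (mi0 n) = 1.
Proof. by rewrite /monomial big1// => j _; rewrite ffunE. Qed.

Lemma monomialD z a b : monomial z (madd a b) = monomial z a * monomial z b.
Proof.
by rewrite /monomial -big_split; apply: eq_bigr => j _ /=; rewrite ffunE exprD.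
Qed.

Lemma monomialZ (k : R[i]) z a :
  monomial (k *: z) a = k ^+ mdeg a * monomial z a.
Proof.
rewrite -prod_pow_mdeg -big_split; apply: eq_bigr => j _ /=.
by rewrite mxE exprMn.
Qed.

Lemma monomial_const (k : R[i]) a :
  monomial (const_mx k) a = k ^+ mdeg a.
Proof. by rewrite -prod_pow_mdeg; apply: eq_bigr => j _; rewrite mxE. Qed.

(** Used to pass to the boundary of the hypercone or to the radius [B]. Bernoulli's inequality for
    [t = 1 - d] reduces the claim to [k X d <= e], and the denominator of [d] also keeps
    [d <= 1]. *)
Lemma approx_expr (X : R) k (e : R) : 0 <= X -> 0 < e ->
  exists t, [/\ 0 <= t, t < 1 & X <= t ^+ k * X + e].
Proof.
move=> X0 e0; pose d := e / (e + k%:R * X + 1).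
have D0 : 0 < e + k%:R * X + 1.
  by rewrite ltr_wpDl// addr_ge0 ?mulr_ge0// ltW.
have d0 : 0 < d by rewrite divr_gt0.
have d1 : d <= 1.
  by rewrite ler_pdivrMr// mul1r -addrA lerDl addr_ge0// mulr_ge0.
exists (1 - d); split; rewrite ?subr_ge0 ?gtrBl//.
have B : 1 - k%:R * d <= (1 - d) ^+ k.
  elim: (k) => [|m IH]; first by rewrite mul0r subr0 expr0.
  rewrite exprS; apply: le_trans (ler_wpM2l _ IH); last by rewrite subr_ge0.
  rewrite -natr1 -subr_ge0.
  have -> : (1 - d) * (1 - m%:R * d) - (1 - (m%:R + 1) * d) = m%:R * d ^+ 2.
    by ring.
  by rewrite mulr_ge0// exprn_ge0// ltW.
apply: le_trans (_ : (1 - k%:R * d) * X + e <= _); last first.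
  by rewrite lerD2r ler_wpM2r.
have : k%:R * X * d <= e.
  rewrite /d mulrCA; apply: ler_piMr; first exact: ltW.
  rewrite ler_pdivrMr// mul1r.
  by rewrite -addrA addrCA lerDl addr_ge0// ltW.
by nra.
Qed.

Lemma sup_monomial_dilate (k : R[i]) a (r : R) : 0 < r ->
  ereal_sup [set (cmod (k * monomial z a))%:E | z in dilate r (@hypercone R n)]
  = (cmod k * msup R a * r ^+ mdeg a)%:E.
Proof.
move=> r0; apply/eqP; rewrite eq_le; apply/andP; split.
  apply: ge_ereal_sup => _ [_ [z Dz <-] <-]; rewrite lee_fin.
  rewrite monomialZ !cmodM cmodX cmod_real gtr0_norm// mulrCA mulrC.
  rewrite ler_wpM2r ?exprn_ge0 ?(ltW r0)// ler_wpM2l ?cmod_ge0//.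
  rewrite cmod_monomial; apply: prod_le_msup; last exact: ltW.
  by move=> j; exact: cmod_ge0.
apply/lee_addgt0Pr => e e0.
have X0 : 0 <= cmod k * msup R a * r ^+ mdeg a.
  by rewrite !mulr_ge0 ?cmod_ge0 ?msup_ge0 ?exprn_ge0// ltW.
have [t [t0 t1 le_t]] := approx_expr (mdeg a) X0 e0.
(* The extremal point [a / |a|] may lie on the boundary of the open hypercone; the factor [t < 1]
   moves it inside. *)
pose w : 'rV[R[i]]_n := \row_j (t * ((a j)%:R / (mdeg a)%:R))%:C.
have wE j : cmod (w 0 j) = t * ((a j)%:R / (mdeg a)%:R).
  by rewrite mxE cmod_real ger0_norm// mulr_ge0 ?divr_ge0.
have Dw : hypercone w.
  rewrite /hypercone /=; under eq_bigr do rewrite wE.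
  rewrite -mulr_sumr (le_lt_trans _ t1)// ler_piMr//.
  exact: sum_mdeg_ratio.
apply: le_trans (_ : (t ^+ mdeg a * (cmod k * msup R a * r ^+ mdeg a) + e)%:E <= _)%E.
  by rewrite lee_fin.
rewrite EFinD leeD2r//; apply: ereal_sup_ubound.
exists (r%:C *: w); first by exists w.
congr (_%:E); rewrite monomialZ !cmodM cmodX cmod_real gtr0_norm//.
rewrite cmod_monomial; under eq_bigr do rewrite wE exprMn.
by rewrite big_split /= prod_pow_mdeg -/(msup R a); ring.
Qed.

Lemma hypercone_ler z (w : 'rV[R[i]]_n) : (forall j, cmod (w 0 j) <= cmod (z 0 j)) ->
  hypercone z -> hypercone w.
Proof. by move=> h; apply: le_lt_trans; apply: ler_sum => j _. Qed.

Definition schur c := forall z, hypercone z ->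
  exists2 s, net_sum (fun a => c a * monomial z a) s & cmod s < 1.

Definition majorant c (r : R) a : R := cmod (c a) * msup R a * r ^+ mdeg a.

Lemma majorant_ge0 c r a : 0 <= r -> 0 <= majorant c r a.
Proof. by move=> r0; rewrite !mulr_ge0 ?cmod_ge0 ?msup_ge0 ?exprn_ge0. Qed.

Lemma schurP c : schur c <->
  (forall z, hypercone z -> ps_cvg c z) /\
  (forall z, hypercone z -> cmod (ps_sum c z) < 1).
Proof.
split=> [h|[h1 h2] z Dz].
  split=> z /h [s /ps_net_sum[//]] _ hs.
  by rewrite /ps_sum /ps_term hs.
by exists (ps_sum c z); [exact: net_sum_ps (h1 _ Dz)|exact: h2].
Qed.

Lemma bohr_propertyP (r : R) : 0 < r -> bohr_property (@hypercone R n) r <->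
  forall c, schur c ->
    (\esum_(a in [set: multiindex n]) (majorant c r a)%:E < 1)%E.
Proof.
move=> r0; split=> h c.
  move=> /schurP[/h{}h /h]; congr (_ < _)%E; apply: eq_esum => a _.
  exact: sup_monomial_dilate.
move=> h1 h2; have /schurP/h : (forall z, hypercone z -> ps_cvg c z) /\
  (forall z, hypercone z -> cmod (ps_sum c z) < 1) by [].
congr (_ < _)%E; apply: eq_esum => a _; symmetry.
exact: sup_monomial_dilate.
Qed.

Lemma esum_leP (T : choiceType) (g : T -> R) (y : R) :
  (\esum_(i in [set: T]) (g i)%:E <= y%:E)%E <->
  forall F : {fset T}, \sum_(i <- F) g i <= y.
Proof.
split=> [h F|h].
  rewrite -lee_fin; apply: le_trans h; apply: ereal_sup_ubound.
  exists [set` F]; first by split=> //; exact: finite_fset.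
  by rewrite fsbig_finite//= set_fsetK sumEFin.
apply: ge_ereal_sup => _ [X [finX _] <-].
by rewrite fsbig_finite//= sumEFin lee_fin.
Qed.

Lemma esum_lt_bound (T : choiceType) (g : T -> R) (y x : R) :
  (forall F : {fset T}, \sum_(i <- F) g i <= y) -> y < x ->
  (\esum_(i in [set: T]) (g i)%:E < x%:E)%E.
Proof. by move=> /esum_leP h yx; apply: le_lt_trans h _; rewrite lte_fin. Qed.

Lemma esum_ltW (T : choiceType) (g : T -> R) (y : R) :
  (\esum_(i in [set: T]) (g i)%:E < y%:E)%E ->
  forall F : {fset T}, \sum_(i <- F) g i < y.
Proof.
move=> h F; rewrite -lte_fin; apply: le_lt_trans h.
apply: ereal_sup_ubound.
exists [set` F]; first by split=> //; exact: finite_fset.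
by rewrite fsbig_finite//= set_fsetK sumEFin.
Qed.

End Majorant.

(** * Orthogonality of characters on tori of roots of unity *)

Section TorusAverage.
Variables (R : realType) (n : nat).
Implicit Types (a b : multiindex n).

(** Over the algebraically closed field [R[i]] the polynomial [X^N - 1] splits, and it is separable
    in characteristic 0; its [N] distinct roots include a primitive one. *)
Lemma complex_prim_root_exists N : (0 < N)%N ->
  exists w : R[i], N.-primitive_root w.
Proof.
move=> N0; have [rs] := closed_field_poly_normal ('X^N - 1 : {poly R[i]}).
rewrite lead_coefXnsubC// scale1r => fact.
have /(has_prim_root N0) roots : all N.-unity_root rs.
  by apply/allP => w; rewrite -root_prod_XsubC -fact.
have /roots : uniq rs.
  rewrite -separable_prod_XsubC -fact; apply: separable_Xn_sub_1.
  by rewrite pnatr_eq0 -lt0n.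
case/(_ _)/hasP => [|w _ prim_w]; last by exists w.
by have := size_XnsubC (1 : R[i]) N0; rewrite fact size_prod_XsubC => -[->].
Qed.

Variables (N : nat) (w : R[i]).
Hypothesis prim_w : N.-primitive_root w.
Let T := {ffun 'I_n -> 'I_N}.

Definition torus_char (k : T) a : R[i] := \prod_(j < n) (w ^+ k j) ^+ a j.

Lemma cmod_prim_root : cmod w = 1.
Proof.
apply/eqP; rewrite -(@pexpr_eq1 _ _ N) ?cmod_ge0 ?(prim_order_gt0 prim_w)//.
by rewrite -cmodX (prim_expr_order prim_w) cmod1.
Qed.

Lemma torus_charD k a b : torus_char k (madd a b) = torus_char k a * torus_char k b.
Proof.
by rewrite -big_split; apply: eq_bigr => j _ /=; rewrite ffunE exprD.
Qed.

Lemma cmod_torus_char k a : cmod (torus_char k a) = 1.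
Proof.
by rewrite cmod_prod big1// => j _; rewrite !cmodX cmod_prim_root !expr1n.
Qed.

(** A geometric sum of ratio [y] with [y ^+ N = 1]. The bounds on [p] and [q] exclude distinct
    exponents congruent modulo [N], for which [y] would be 1. *)
Lemma sum_prim_root p q : (p < N)%N -> (q < N)%N ->
  \sum_(i < N) (w ^+ i) ^+ p * ((w ^+ i) ^+ q)^* = (N * (p == q))%:R.
Proof.
move=> pN qN.
have wJ : w * w^* = 1 by rewrite mulcJ_cmod cmod_prim_root expr1n.
pose y := w ^+ p * w^* ^+ q.
have -> : \sum_(i < N) (w ^+ i) ^+ p * ((w ^+ i) ^+ q)^* = \sum_(i < N) y ^+ i.
  apply: eq_bigr => i _.
  by rewrite /y !rmorphXn /= exprMn -!exprM mulnC [(q * i)%N]mulnC.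
have [pq|pq] := eqVneq p q.
  rewrite /y pq -exprMn wJ expr1n muln1.
  by under eq_bigr do rewrite expr1n; rewrite sumr_const card_ord.
rewrite muln0.
have y1 : y != 1.
  apply: contra pq => /eqP y1; rewrite -(modn_small pN) -(modn_small qN).
  rewrite -(eq_prim_root_expr prim_w).
  by rewrite -[w ^+ q]mul1r -y1 /y -mulrA -exprMn [_^* * _]mulrC wJ expr1n mulr1.
have yN : y ^+ N = 1.
  rewrite /y exprMn exprAC (prim_expr_order prim_w) expr1n mul1r exprAC.
  by rewrite -rmorphXn /= (prim_expr_order prim_w) rmorph1 expr1n.
apply: (mulfI (_ : y - 1 != 0)); first by rewrite subr_eq0.
by rewrite mulr0 -subrX1 yN subrr.
Qed.

Lemma sum_torus_char a b : a \in mbox n N -> b \in mbox n N ->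
  \sum_(k : T) torus_char k a * (torus_char k b)^* = (N ^ n * (a == b))%:R.
Proof.
rewrite !in_mbox => /forallP aN /forallP bN.
transitivity (\sum_(k : T) \prod_(j < n)
    ((w ^+ k j) ^+ a j * ((w ^+ k j) ^+ b j)^*)).
  by apply: eq_bigr => k _; rewrite big_split /= rmorph_prod.
rewrite -(bigA_distr_bigA (fun (j : 'I_n) (i : 'I_N) =>
  (w ^+ i) ^+ a j * ((w ^+ i) ^+ b j)^*)) /=.
under eq_bigr do rewrite sum_prim_root//.
have [->|] := eqVneq a b.
  by under eq_bigr do rewrite eqxx muln1; rewrite muln1 prodr_const card_ord natrX.
move=> ab; rewrite muln0.
have [j abj] : exists j, a j != b j.
  by apply/existsP; rewrite -negb_forall; apply: contra ab => /forallP h;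
    apply/eqP/ffunP => j; apply/eqP.
by rewrite (bigD1 j)//= (negbTE abj) muln0 mul0r.
Qed.

End TorusAverage.

(** * Positivity of the Toeplitz matrix of a function with real part at most 1 *)

Section Gram.
Variables (R : realType) (n : nat).
Implicit Types (a b d : multiindex n).

Definition rotate (t : 'I_n -> R[i]) (z : 'rV[R[i]]_n) : 'rV[R[i]]_n :=
  \row_j (t j * z 0 j).

(* The values [1 - Re f] on the torus through [z] are the weights of a positive
   measure; pairing it with the square of a trigonometric polynomial shows that
   the Toeplitz matrix of the coefficients of [1 - Re f] is positive. *)
Lemma toeplitz_positive (c : multiindex n -> R[i]) (z : 'rV[R[i]]_n)
    (I : finType) (e : I -> multiindex n) (q : I -> R[i]) (A : I -> I -> R[i]) :
  (forall t, (forall j, cmod (t j) = 1) -> exists2 s,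
     net_sum (fun a => c a * monomial (rotate t z) a) s & Re s <= 1) ->
  (forall i j d, madd d (e i) = e j -> A i j = c d * monomial z d) ->
  (forall i j, (forall d, madd d (e i) != e j) -> A i j = 0) ->
  Re (\sum_i \sum_j q i * (q j)^*%C * A i j)
  <= Re (\sum_i \sum_j q i * (q j)^*%C * (e i == e j)%:R).
Proof.
move=> hc hA hA0.
set X := \sum_i _; set S := \sum_i _.
pose M := (\max_i mdeg (e i)).+1.
have eM i : (mdeg (e i) < M)%N by rewrite ltnS; apply: leq_bigmax.
have [s1 net1 _] : exists2 s, net_sum (fun a => c a * monomial z a) s & Re s <= 1.
  have [|s hs s1] := hc (fun=> 1); first by move=> j; exact: cmod1.
  exists s => //; congr (net_sum _ s): hs.
  apply/funext => a; congr (_ * _); apply: eq_bigr => j _.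
  by rewrite mxE mul1r.
(* Truncating the series to a finite set costs [eps]; the sign of [Re S] is needed to let [eps] tend
   to 0. *)
suff H (eps : R) : 0 < eps -> Re X <= (1 + eps) * Re S /\ 0 <= Re S.
  have S0 : 0 <= Re S by have [] := H 1 ltr01.
  apply/ler_addgt0Pr => d d0.
  have [|+ _] := H (d / (Re S + 1)); first by rewrite divr_gt0// ltr_wpDl.
  move=> /le_trans; apply.
  rewrite mulrDl mul1r lerD2l -mulrA ler_piMr ?(ltW d0)//.
  by rewrite mulrC ler_pdivrMr ?ltr_wpDl// mul1r lerDl.
move=> eps0.
have [F0 tail] := net_sum_tail net1 eps0.
(* The added box contains every [d] with [madd d (e i) = e j], so no entry of [A] is lost in the
   truncation. *)
pose F := (F0 `|` mbox n M)%fset.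
have {}tail G : [disjoint G & F]%fset ->
    \sum_(i <- G) cmod (c i * monomial z i) <= eps.
  by move=> GF; apply: tail; apply: fdisjointWr GF; exact: fsubsetUl.
have [N0 FN0] := fsub_mbox F.
(* Large enough that all [e i] and all [madd d (e i)] with [d] in [F] lie in [mbox n N], where the
   characters are orthogonal. *)
pose N := (N0 + M)%N.
have [|w prim_w] := @complex_prim_root_exists R N; first by rewrite addn_gt0 orbT.
have eN i : e i \in mbox n N.
  by apply: mbox_mdeg; apply: leq_trans (eM i) _; exact: leq_addl.
have deN i d : d \in F -> madd d (e i) \in mbox n N.
  move=> /(fsubsetP FN0); rewrite !in_mbox => /forallP h; apply/forallP => j.
  rewrite ffunE -addSn leq_add//; apply: ltnW.
  exact: leq_ltn_trans (mdeg_ge _ _) (eM i).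
pose chi := @torus_char R n N w.
pose P (k : {ffun 'I_n -> 'I_N}) := \sum_(d <- F) c d * monomial z d * chi k d.
pose Q (k : {ffun 'I_n -> 'I_N}) := \sum_i q i * chi k (e i).
have hP k : Re (P k) <= 1 + eps.
  have [|s hs s1'] := hc (fun j => w ^+ k j).
    by move=> j; rewrite cmodX (cmod_prim_root prim_w) expr1n.
  have {}hs : net_sum (fun d => c d * monomial z d * chi k d) s.
    congr (net_sum _ s): hs; apply/funext => a; rewrite -mulrA; congr (_ * _).
    by rewrite -big_split /=; apply: eq_bigr => j _; rewrite mxE exprMn mulrC.
  have := net_sum_approx _ net1 hs tail.
  have h d : cmod (c d * monomial z d * chi k d) <= cmod (c d * monomial z d).
    by rewrite cmodM /chi (cmod_torus_char prim_w) mulr1.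
  move=> /(_ h); rewrite -/(P k) => l.
  have -> : P k = s - (s - P k) by ring.
  rewrite ReD ReN lerD//.
  apply: le_trans (_ : `|Re (s - P k)| <= _); first by rewrite -normrN ler_norm.
  exact: le_trans (ler_Re_cmod _) l.
have QQ k : Q k * (Q k)^* = \sum_i \sum_j q i * (q j)^* * (chi k (e i) * (chi k (e j))^*).
  rewrite /Q rmorph_sum mulr_suml; apply: eq_bigr => i _.
  rewrite mulr_sumr; apply: eq_bigr => j _; rewrite rmorphM /=; ring.
have SE : \sum_k Q k * (Q k)^* = (N ^ n)%:R * S.
  under eq_bigr do rewrite QQ.
  rewrite exchange_big /= mulr_sumr; apply: eq_bigr => i _.
  rewrite exchange_big /= mulr_sumr; apply: eq_bigr => j _.
  by rewrite -mulr_sumr sum_torus_char// natrM; ring.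
(* Orthogonality keeps exactly the triples with [madd d (e i) = e j], and [d] is then determined by
   [i] and [j]. *)
have XE : \sum_k P k * (Q k * (Q k)^*) = (N ^ n)%:R * X.
  transitivity (\sum_i \sum_j \sum_(d <- F) q i * (q j)^* * (c d * monomial z d) *
     \sum_k chi k (madd d (e i)) * (chi k (e j))^*).
    rewrite (eq_bigr (fun k => \sum_i \sum_j \sum_(d <- F) q i * (q j)^* *
      (c d * monomial z d) * (chi k (madd d (e i)) * (chi k (e j))^*))).
      rewrite exchange_big /=; apply: eq_bigr => i _.
      rewrite exchange_big /=; apply: eq_bigr => j _.
      by rewrite exchange_big /=; apply: eq_bigr => d _; rewrite -mulr_sumr.
    move=> k _; rewrite QQ mulr_sumr; apply: eq_bigr => i _.
    rewrite mulr_sumr; apply: eq_bigr => j _.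
    rewrite /P mulr_suml; apply: eq_bigr => d _.
    rewrite /chi torus_charD; ring.
  rewrite mulr_sumr; apply: eq_bigr => i _.
  rewrite mulr_sumr; apply: eq_bigr => j _.
  transitivity (\sum_(d <- F) q i * (q j)^* * (c d * monomial z d)
      * (N ^ n * (madd d (e i) == e j))%:R).
    by rewrite big_seq [RHS]big_seq; apply: eq_bigr => d dF;
      rewrite sum_torus_char// deN.
  have [[d hd]|no] := pselect (exists d, madd d (e i) = e j).
    have dF : d \in F.
      rewrite inE; apply/orP; right; apply: mbox_mdeg.
      by apply: leq_ltn_trans (eM j); rewrite -hd mdegD leq_addr.
    rewrite (hA _ _ _ hd) (big_fsetD1 d)//= hd eqxx muln1 big_seq big1 ?addr0.
      by ring.
    move=> d'; rewrite !inE => /andP[dd _]; rewrite -hd maddC [madd d _]maddC.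
    by rewrite (inj_eq (@maddI _ _)) (negbTE dd) muln0 mulr0.
  rewrite (hA0 i j) ?mulr0; last by move=> d; apply/eqP => h; apply: no; exists d.
  rewrite big1 ?mulr0// => d _.
  by case: eqP => [h|_]; [case: no; exists d|rewrite muln0 mulr0].
have Nn : (0 : R) < (N ^ n)%:R by rewrite ltr0n expn_gt0 addn_gt0 orbT.
have ReN x : Re ((N ^ n)%:R * x) = (N ^ n)%:R * Re x :> R.
  by rewrite -Re_scale rmorph_nat.
split; last first.
  rewrite -(pmulr_rge0 _ Nn) -ReN -SE Re_sum sumr_ge0// => k _.
  by rewrite mulcJ_cmod /= exprn_ge0// cmod_ge0.
rewrite -(ler_pM2l Nn) mulrCA -!ReN -XE -SE !Re_sum mulr_sumr.
apply: ler_sum => k _; rewrite mulcJ_cmod mulrC Re_scale /= mulrC.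
by rewrite ler_wpM2r ?exprn_ge0 ?cmod_ge0.
Qed.

End Gram.

(** * Exponents supported on one or two coordinates *)

Section UnitMultiindex.
Variables (R : realType) (n : nat).

Definition mpt (i : 'I_n) (k : nat) : multiindex n :=
  [ffun j => if j == i then k else 0%N].

Lemma mdeg_mpt i k : mdeg (mpt i k) = k.
Proof.
rewrite /mdeg (bigD1 i)//= big1 ?addn0 ?ffunE ?eqxx// => j ji.
by rewrite ffunE (negbTE ji).
Qed.

Lemma msup_mpt i k : msup R (mpt i k.+1) = 1.
Proof.
rewrite /msup (bigD1 i)//= big1 ?mulr1 ?mdeg_mpt ?ffunE ?eqxx ?divff ?expr1n//.
by move=> j ji; rewrite ffunE (negbTE ji) expr0.
Qed.

Lemma msup_mpt2 i j : i != j -> msup R (madd (mpt i 1) (mpt j 1)) = 1 / 4.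
Proof.
move=> ij; rewrite /msup mdegD !mdeg_mpt (bigD1 i)//= (bigD1 j) 1?eq_sym//=.
rewrite big1 ?mulr1.
  by rewrite !ffunE !eqxx (negbTE ij) eq_sym (negbTE ij) /= !expr1; field.
by move=> k /andP[ki kj]; rewrite !ffunE (negbTE ki) (negbTE kj) expr0.
Qed.

End UnitMultiindex.

(** * Coefficient bounds from Toeplitz positivity *)

Section CoefficientBounds.
Variables (R : realType) (n : nat) (c : multiindex n -> R[i]).
Hypothesis schur_c : schur c.
Implicit Types (a b d : multiindex n) (z : 'rV[R[i]]_n).

Local Notation L := (2 * (1 - Re (c (mi0 n)))).

Lemma big_option_bool (F : option bool -> R[i]) :
  \sum_i F i = F None + (F (Some true) + F (Some false)).
Proof.
rewrite (bigD1 None)//= (bigD1 (Some true))//= (bigD1 (Some false))//=.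
by rewrite big1 ?addr0// => -[[]|].
Qed.

Lemma schur_coef0 : cmod (c (mi0 n)) < 1.
Proof.
have [|s hs s1] := schur_c (_ : hypercone (const_mx 0)).
  by rewrite /hypercone /= big1// => j _; rewrite mxE cmod0.
suff <- : s = c (mi0 n) by [].
apply: net_sum_unique hs _.
have := @net_sum_finite R _ (fun a => c a * monomial (const_mx 0) a)
  [fset mi0 n]%fset.
rewrite big_seq_fset1 monomial0 mulr1; apply => a.
by rewrite inE -mdeg_eq0 monomial_const expr0n => /negbTE ->; rewrite mulr0.
Qed.

Lemma schur_rotate z t : hypercone z -> (forall j, cmod (t j) = 1) ->
  exists2 s, net_sum (fun a => c a * monomial (rotate t z) a) s & Re s <= 1.
Proof.
move=> Dz t1; have [|s hs s1] := schur_c (_ : hypercone (rotate t z)).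
  by apply: hypercone_ler Dz => j; rewrite mxE cmodM t1 mul1r.
by exists s => //; exact: le_trans (Re_le_cmod _) (ltW s1).
Qed.

Lemma madd_eqr d a : madd d a = a -> d = mi0 n.
Proof. by rewrite maddC -{2}(madd0 a) => /maddI. Qed.

Lemma schur_L_gt0 : 0 < L.
Proof. by rewrite mulr_gt0// subr_gt0 (le_lt_trans (Re_le_cmod _))// schur_coef0. Qed.

(** For the exponents 0 and [a], with weights the conjugate of [A] and [|A|], positivity reads
    [|A|^3 + 2 |A|^2 Re c_0 <= 2 |A|^2]. *)
Lemma schur_coef_le z a : hypercone z -> a != mi0 n ->
  cmod (c a * monomial z a) <= L.
Proof.
move=> Dz a0; set A := c a * monomial z a.
pose e (i : bool) := if i then a else mi0 n.
pose q (i : bool) : R[i] := if i then (cmod A)%:C else A^*%C.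
pose M (i j : bool) : R[i] :=
  if i == j then c (mi0 n) else if j then A else 0.
have h1 i j d : madd d (e i) = e j -> M i j = c d * monomial z d.
  rewrite /M /e; case: i j => [] [] /= h.
  - by rewrite (madd_eqr h) monomial0 mulr1.
  - by move: h => /(congr1 (@mdeg n))/eqP; rewrite mdegD mdeg0 addn_eq0 andbC
      mdeg_eq0 (negbTE a0).
  - by rewrite /A -h madd0.
  - by rewrite (madd_eqr h) monomial0 mulr1.
have h2 i j : (forall d, madd d (e i) != e j) -> M i j = 0.
  rewrite /M /e; case: i j => [] [] //= h.
  - by have := h (mi0 n); rewrite madd0m eqxx.
  - by have := h a; rewrite madd0 eqxx.
  - by have := h (mi0 n); rewrite madd0m eqxx.
have := toeplitz_positive q (fun t => @schur_rotate z t Dz) h1 h2.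
have qt : (q true)^*%C = (cmod A)%:C by exact: conjc_real.
have qf : (q false)^*%C = A by exact: conjcK.
rewrite !big_bool qt qf /q /e /M /= !eqxx [mi0 n == a]eq_sym (negbTE a0).
rewrite !(mulr0, mulr1, addr0, add0r).
have -> : A^*%C * (cmod A)%:C * A = (cmod A ^+ 3)%:C.
  by rewrite mulrAC [A^*%C * A]mulrC mulcJ_cmod -rmorphM /= -exprSr.
rewrite [A^*%C * A]mulrC mulcJ_cmod -!rmorphM !ReD !Re_scale /= => h.
have := cmod_ge0 A; rewrite le_eqVlt => /orP[/eqP <-|A0].
  exact: ltW schur_L_gt0.
rewrite -(ler_pM2l (exprn_gt0 2 A0)) -exprSr.
by move: h; set x := cmod A; set y := Re _; nra.
Qed.

Lemma schur_msup_le a : a != mi0 n -> cmod (c a) * msup R a <= L.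
Proof.
move=> a0; have := @sup_monomial_dilate R n (c a) a 1 ltr01.
rewrite expr1n mulr1 -lee_fin => <-; apply: ge_ereal_sup => _ [_ [w Dw <-] <-].
by rewrite lee_fin rmorph1 scale1r schur_coef_le.
Qed.

(** Three exponents in a star, with weight [T = sqrt (|A|^2 + |B|^2)] at the hub and the conjugates
    of [A] and [B] at the ends, give [T^3 + 2 T^2 Re c_0 <= 2 T^2]. *)
Lemma schur_pair_le i0 i1 z : i0 != i1 -> hypercone z ->
  cmod (c (madd (mpt i0 1) (mpt i1 1))
        * monomial z (madd (mpt i0 1) (mpt i1 1))) ^+ 2
  + cmod (c (mpt i0 2) * monomial z (mpt i0 2)) ^+ 2 <= L ^+ 2.
Proof.
move=> ne_i Dz; set a := madd _ _; set b := mpt i0 2.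
set A := c a * _; set B := c b * _.
pose T := Num.sqrt (cmod A ^+ 2 + cmod B ^+ 2).
have S0 : 0 <= cmod A ^+ 2 + cmod B ^+ 2 by rewrite addr_ge0 ?exprn_ge0 ?cmod_ge0.
have T2 : T ^+ 2 = cmod A ^+ 2 + cmod B ^+ 2 by rewrite sqr_sqrtr.
(* [None] is the hub: adding [a], resp. [b], to the two other exponents gives it. *)
pose e (i : option bool) := match i with
  | None => madd b (mpt i1 1)
  | Some true => mpt i0 1
  | Some false => mpt i1 1 end.
pose q (i : option bool) : R[i] := match i with
  | None => T%:C
  | Some true => A^*%C
  | Some false => B^*%C end.
pose M (i j : option bool) : R[i] :=
  if i == j then c (mi0 n) else
  match i, j with
  | Some true, None => A
  | Some false, None => B
  | _, _ => 0 end.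
have eA : madd a (mpt i0 1) = madd b (mpt i1 1).
  by apply/ffunP => j; rewrite !ffunE; case: (j == i0); case: (j == i1).
have ne_e i j d : i != j -> j != None -> madd d (e i) != e j.
  move=> ij j0; apply/eqP => /ffunP H; have := H i0; have := H i1; rewrite /e.
  have ne_i' : (i1 == i0) = false by rewrite eq_sym (negbTE ne_i).
  by case: i j ij j0 {H} => [[]|] [[]|] //= _ _;
    rewrite !ffunE !eqxx (negbTE ne_i) ne_i'; lia.
have h1 i j d : madd d (e i) = e j -> M i j = c d * monomial z d.
  move=> h; rewrite /M; have [ij|ij] := eqVneq i j.
    by move: h; rewrite ij => /madd_eqr ->; rewrite monomial0 mulr1.
  case: j ij h => [j|] ij h; first by have := ne_e _ (Some j) d ij isT; rewrite h eqxx.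
  case: i ij h => [[]|] // _ /=.
    by rewrite -eA maddC [madd a _]maddC => /maddI ->.
  by rewrite maddC [madd b _]maddC => /maddI ->.
have h2 i j : (forall d, madd d (e i) != e j) -> M i j = 0.
  move=> h; rewrite /M; have [ij|ij] := eqVneq i j.
    by have := h (mi0 n); rewrite ij madd0m eqxx.
  case: i j ij h => [[]|] [[]|] // _ h.
    by have := h a; rewrite /= eA eqxx.
  by have := h b; rewrite /= eqxx.
have := toeplitz_positive q (fun t => @schur_rotate z t Dz) h1 h2.
have nE i j : i != j -> (e i == e j) = false.
  move=> ij; apply/negbTE; have [j0|j0] := eqVneq j None.
    rewrite eq_sym -(madd0m (e j)); apply: ne_e; first by rewrite eq_sym.
    by rewrite -j0.
  by rewrite -(madd0m (e i)); exact: ne_e.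
have q0 : (q None)^*%C = T%:C by exact: conjc_real.
have qt : (q (Some true))^*%C = A by exact: conjcK.
have qf : (q (Some false))^*%C = B by exact: conjcK.
rewrite !big_option_bool !q0 !qt !qf !eqxx !nE// /M /q /=.
rewrite !(mulr0, mulr1, addr0, add0r).
have EA : A^*%C * T%:C * A = (T * cmod A ^+ 2)%:C.
  by rewrite mulrAC [A^*%C * A]mulrC mulcJ_cmod -rmorphM /= mulrC.
have EB : B^*%C * T%:C * B = (T * cmod B ^+ 2)%:C.
  by rewrite mulrAC [B^*%C * B]mulrC mulcJ_cmod -rmorphM /= mulrC.
rewrite EA EB [A^*%C * A]mulrC [B^*%C * B]mulrC !mulcJ_cmod -!rmorphM.
rewrite !ReD !Re_scale /= => h.
have L0 := schur_L_gt0.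
rewrite -T2 ler_sqr ?nnegrE ?sqrtr_ge0 ?(ltW L0)//.
have := sqrtr_ge0 (cmod A ^+ 2 + cmod B ^+ 2); rewrite -/T le_eqVlt.
move=> /orP[/eqP <-|T0]; first exact: ltW.
rewrite -(ler_pM2l (exprn_gt0 2 T0)) -exprSr.
have AE : cmod A ^+ 2 = T ^+ 2 - cmod B ^+ 2 by rewrite T2 addrK.
by move: h; rewrite AE; set y := cmod B; set m := Re _; lra.
Qed.

(** Bounding the two terms separately would give [2 L]; the saving [L / 128] is what pushes the
    radius beyond [1 - (2/3)^(1/n)]. *)
Lemma schur_msup_pair_le i0 i1 : i0 != i1 ->
  cmod (c (madd (mpt i0 1) (mpt i1 1))) * msup R (madd (mpt i0 1) (mpt i1 1))
  + cmod (c (mpt i0 2)) * msup R (mpt i0 2) <= (2 - 1 / 128) * L.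
Proof.
move=> ne_i; rewrite msup_mpt msup_mpt2// mulr1.
have := schur_msup_le (_ : mpt i0 2 != mi0 n).
have := schur_msup_le (_ : madd (mpt i0 1) (mpt i1 1) != mi0 n).
rewrite -!mdeg_gt0 !mdegD !mdeg_mpt msup_mpt msup_mpt2// mulr1 => /(_ isT) hx /(_ isT) hy.
have : (cmod (c (madd (mpt i0 1) (mpt i1 1))) / 4) ^+ 2
    + (cmod (c (mpt i0 2)) / 4) ^+ 2 <= L ^+ 2.
  set X := _ + _.
  have X0 : 0 <= X by rewrite addr_ge0// exprn_ge0// divr_ge0 ?cmod_ge0.
  apply/ler_addgt0Pr => d d0; have [t [t0 t1 le_t]] := approx_expr 4 X0 d0.
  apply: le_trans le_t _; rewrite lerD2r.
  (* At this point both monomials have modulus [t^2 / 4], so the squares in [schur_pair_le] carry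
     the factor [t ^+ 4] of [le_t]. *)
  pose z : 'rV[R[i]]_n := \row_j (if (j == i0) || (j == i1) then t / 2 else 0)%:C.
  have zE j : cmod (z 0 j) = if (j == i0) || (j == i1) then t / 2 else 0.
    by rewrite mxE cmod_real; case: ifP; rewrite ger0_norm ?divr_ge0.
  have ne_i' : (i1 == i0) = false by rewrite eq_sym (negbTE ne_i).
  have Dz : hypercone z.
    rewrite /hypercone /= (bigD1 i0)//= (bigD1 i1) ?ne_i'//= big1.
      by rewrite !zE !eqxx orbT /=; lra.
    by move=> j /andP[j0 j1]; rewrite zE (negbTE j0) (negbTE j1).
  have monE a : (forall j, j != i0 -> j != i1 -> a j = 0%N) ->
      cmod (monomial z a) = (t / 2) ^+ mdeg a.
    move=> ha; rewrite cmod_monomial -prod_pow_mdeg; apply: eq_bigr => j _.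
    rewrite zE; case: ifPn => //; rewrite negb_or => /andP[j0 j1].
    by rewrite ha// !expr0.
  apply: le_trans (schur_pair_le ne_i Dz).
  rewrite !cmodM !monE ?mdegD ?mdeg_mpt.
  - by rewrite le_eqVlt; apply/orP; left; apply/eqP; rewrite /X; field.
  - by move=> j j0 _; rewrite ffunE (negbTE j0).
  - by move=> j j0 j1; rewrite !ffunE (negbTE j0) (negbTE j1).
have := schur_L_gt0; have := cmod_ge0 (c (mpt i0 2)).
have := cmod_ge0 (c (madd (mpt i0 1) (mpt i1 1))).
move: hx hy; move: (cmod (c (madd _ _))) (cmod (c (mpt _ _))) L => x y l.
move=> hx hy x0 y0 L0 h.
(* Either [y] is at most half its bound, or [(y / 4)^2 > l^2 / 64] forces
   [(x / 4)^2 <= (1 - 1/64) l^2], and [1 - 1/64 <= (1 - 1/128)^2]. *)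
have [yL|yL] := leP y (l / 2); first by lra.
suff : x / 4 <= (1 - 1 / 128) * l by lra.
rewrite -ler_sqr ?nnegrE ?divr_ge0 ?mulr_ge0 ?(ltW L0)//; last by lra.
by nra.
Qed.


End CoefficientBounds.

(** * The lower bound for the Bohr radius *)

Section LowerBound.
Variables (R : realType) (n : nat).
Implicit Types (a b : multiindex n) (c : multiindex n -> R[i]).

Lemma schurZ (k : R[i]) c : cmod k = 1 -> schur c -> schur (fun a => k * c a).
Proof.
move=> k1 hc z /hc[s hs s1]; exists (k * s); last by rewrite cmodM k1 mul1r.
by apply: net_sum_ext (net_sumZ k hs) => a; rewrite mulrA.
Qed.

(** Multiplication by a unimodular constant makes the constant coefficient nonnegative and leaves
    all moduli unchanged. *)
Lemma schur_normalize c : schur c -> exists c', [/\ schur c',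
  c' (mi0 n) = (cmod (c (mi0 n)))%:C & forall r, majorant c' r =1 majorant c r].
Proof.
move=> hc; have [c0|c0] := eqVneq (c (mi0 n)) 0.
  by exists c; split; rewrite // c0 cmod0.
pose k := (cmod (c (mi0 n)))%:C / c (mi0 n).
have k1 : cmod k = 1.
  by rewrite cmodM cmodV cmod_real ger0_norm ?cmod_ge0// divff// cmod_eq0.
exists (fun a => k * c a); split; first exact: schurZ.
  by rewrite /k divfK.
by move=> r a; rewrite /majorant cmodM k1 mul1r.
Qed.

Lemma sum_mbox_geometric (r : R) N : 0 <= r -> r < 1 ->
  \sum_(a <- mbox n N) r ^+ mdeg a <= (1 - r)^-1 ^+ n.
Proof.
move=> r0 r1; under eq_bigr do rewrite -prod_pow_mdeg.
rewrite (sum_mbox (fun=> fun k => r ^+ k)) prodr_const card_ord.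
apply: lerXn2r; rewrite ?nnegrE ?invr_ge0 ?subr_ge0 ?(ltW r1)//.
  by apply: sumr_ge0 => k _; rewrite exprn_ge0.
rewrite -[leRHS]mul1r ler_pdivlMr ?subr_gt0// mulrC.
have -> : (1 - r) * \sum_(k < N) r ^+ k = 1 - r ^+ N.
  by rewrite -[1 - r ^+ N]opprB subrX1 -mulNr opprB.
by rewrite gerBl exprn_ge0.
Qed.

(** The bound [2 (1 - x) r^|a|] on every nonconstant term sums to a multiple of [(1 - r)^(-n) - 1];
    the two selected terms of degree 2 together save [r^2 / 128] in that multiple. *)
Lemma sum_majorant_le c (x r : R) (i0 i1 : 'I_n)
    (F : {fset multiindex n}) : i0 != i1 ->
  schur c -> c (mi0 n) = x%:C -> 0 <= x -> 0 <= r -> r < 1 ->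
  \sum_(a <- F) majorant c r a
  <= x + 2 * (1 - x) * ((1 - r)^-1 ^+ n - 1 - r ^+ 2 / 128).
Proof.
move=> ne_i hc c0 x0 r0 r1.
have L0 := schur_L_gt0 hc; rewrite c0 /= in L0.
have [N0 FN0] := fsub_mbox F; pose N := (N0 + 3)%N.
have FN := fsubset_trans FN0 (mbox_sub n (leq_addr 3 N0)).
apply: le_trans (ler_sum_fsubset (fun a => majorant_ge0 c a r0) FN) _.
set a := madd (mpt i0 1) (mpt i1 1); set b := mpt i0 2.
have da : mdeg a = 2%N by rewrite mdegD !mdeg_mpt.
have db : mdeg b = 2%N by rewrite mdeg_mpt.
have a0 : a != mi0 n by rewrite -mdeg_gt0 da.
have b0 : b != mi0 n by rewrite -mdeg_gt0 db.
have ab : a != b.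
  apply/eqP => /ffunP/(_ i1); rewrite !ffunE eqxx eq_sym (negbTE ne_i) //.
pose G := (mbox n N `\ mi0 n `\ a `\ b)%fset.
have split3 (g : multiindex n -> R) : \sum_(d <- mbox n N) g d
    = g (mi0 n) + (g a + (g b + \sum_(d <- G) g d)).
  have inN d : (mdeg d <= 2)%N -> d \in mbox n N.
    by move=> h; apply: mbox_mdeg; rewrite /N; lia.
  rewrite (big_fsetD1 (mi0 n)) ?inN ?mdeg0//=; congr (_ + _).
  rewrite (big_fsetD1 a) ?inE ?a0 ?inN ?da//=; congr (_ + _).
  by rewrite (big_fsetD1 b) ?inE ?b0 1?eq_sym ?ab ?inN ?db.
have := sum_mbox_geometric N r0 r1; rewrite !split3 mdeg0 da db expr0.
have pair := schur_msup_pair_le hc ne_i; rewrite -/a -/b c0 /= in pair.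
have r20 : 0 <= r ^+ 2 by rewrite exprn_ge0.
have {}pair := ler_wpM2r r20 pair.
have rest : \sum_(d <- G) majorant c r d
    <= 2 * (1 - x) * \sum_(d <- G) r ^+ mdeg d.
  rewrite mulr_sumr big_seq [leRHS]big_seq; apply: ler_sum => d.
  rewrite !inE => /and4P[_ _ d0 _]; rewrite ler_wpM2r ?exprn_ge0//.
  by have := schur_msup_le hc d0; rewrite c0.
move: rest; set Sr := \sum_(d <- _) r ^+ _; set Sm := \sum_(d <- _) _ => rest geo.
have {}geo := ler_wpM2l (ltW L0) geo.
have -> : majorant c r (mi0 n) = x.
  by rewrite /majorant c0 cmod_real ger0_norm// msup0 mdeg0 expr0 !mulr1.
rewrite lerD2l addrA /majorant da db -mulrDl.
apply: le_trans (lerD pair rest) _.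
by move: geo; set g := _ ^+ n; lra.
Qed.

Lemma bohr_lower : (2 <= n)%N -> exists r : R,
  [/\ 0 < r, 1 - (2 / 3) `^ n%:R^-1 < r & bohr_property (@hypercone R n) r].
Proof.
move=> n2; pose i0 : 'I_n := Ordinal (ltnW n2); pose i1 : 'I_n := Ordinal n2.
have n0 : (0 : R) < n%:R^-1 by rewrite invr_gt0 ltr0n ltnW.
set r0 : R := 1 - _.
(* Chosen so that [(1 - r)^(-n)] exceeds [3 / 2] by half of the saving [r0^2 / 128]; the factor of
   [1 - x] in [sum_majorant_le] is then at most [1 - r0^2 / 128]. *)
pose q : R := (3 / 2 + r0 ^+ 2 / 256)^-1.
have D0 : 0 < 3 / 2 + r0 ^+ 2 / 256 by have := sqr_ge0 r0; lra.
have r0_gt0 : 0 < r0.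
  rewrite subr_gt0; apply: lt_le_trans (_ : 1 `^ n%:R^-1 <= 1); last by rewrite powR1.
  by apply: gt0_ltr_powR => //; rewrite ?nnegrE; lra.
have q0 : 0 < q by rewrite invr_gt0.
have q23 : q < 2 / 3.
  have -> : 2 / 3 = (3 / 2 : R)^-1 by rewrite invf_div.
  by rewrite ltf_pV2 ?posrE; have := exprn_gt0 2 r0_gt0; lra.
pose r : R := 1 - q `^ n%:R^-1.
have r0r : r0 < r.
  rewrite ltrD2l ltrN2; apply: gt0_ltr_powR => //; rewrite nnegrE; lra.
have r1 : r < 1 by rewrite gtrBl powR_gt0.
have r_gt0 : 0 < r := lt_trans r0_gt0 r0r.
have rn : (1 - r)^-1 ^+ n = 3 / 2 + r0 ^+ 2 / 256.
  have -> : 1 - r = q `^ n%:R^-1 by rewrite /r opprB addrCA subrr addr0.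
  rewrite exprVn -[_ ^+ n]powR_mulrn ?powR_ge0// -powRrM mulVf ?powRr1 ?(ltW q0) ?invrK//.
  by rewrite pnatr_eq0 -lt0n ltnW.
exists r; split => //; apply/bohr_propertyP => // c hc.
have [c' [hc' c0 maj]] := schur_normalize hc.
have x0 := cmod_ge0 (c (mi0 n)); have x1 := schur_coef0 hc.
move: c0 x0 x1; set x := cmod _ => c0 x0 x1.
apply: (@esum_lt_bound _ _ _ (x + (1 - x) * (1 - r0 ^+ 2 / 128))).
  move=> F; rewrite -(eq_bigr _ (fun a _ => maj r a)).
  apply: le_trans (@sum_majorant_le _ _ _ i0 i1 _ _ hc' c0 x0 (ltW r_gt0) r1) _.
    by [].
  rewrite rn lerD2l mulrAC mulrC ler_wpM2l ?subr_ge0 ?(ltW x1)//.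
  have : r0 ^+ 2 <= r ^+ 2 by rewrite ler_sqr ?nnegrE ltW.
  by lra.
have := exprn_gt0 2 r0_gt0; nra.
Qed.

End LowerBound.

(** * The multinomial expansion, by counting words *)

Section Multinomial.
Variable n : nat.
Implicit Types (a : multiindex n).

Definition mcount k (f : {ffun 'I_k -> 'I_n}) : multiindex n :=
  [ffun j => #|[pred i | f i == j]|].

(* The multinomial coefficient [k! / a!] if [|a| = k], and 0 otherwise. *)
Definition multinom k a : nat := #|[pred f : {ffun 'I_k -> 'I_n} | mcount f == a]|.

Lemma prod_mcount (A : comPzSemiRingType) (x : 'I_n -> A) k
    (f : {ffun 'I_k -> 'I_n}) :
  \prod_(i < k) x (f i) = \prod_(j < n) x j ^+ mcount f j.
Proof.
rewrite (partition_big f predT)//=; apply: eq_bigr => j _.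
rewrite ffunE -prodr_const; apply: eq_big => [i|i /eqP ->//].
by rewrite inE.
Qed.

Lemma mdeg_mcount k (f : {ffun 'I_k -> 'I_n}) : mdeg (mcount f) = k.
Proof.
rewrite /mdeg -[RHS](card_ord k) -sum1_card (partition_big f predT)//=.
by apply: eq_bigr => j _; rewrite ffunE -sum1_card.
Qed.

Lemma multinom_eq0 k a : mdeg a != k -> multinom k a = 0%N.
Proof.
move=> ak; apply: eq_card0 => f; rewrite inE; apply/negbTE.
by apply: contra ak => /eqP <-; rewrite mdeg_mcount.
Qed.

(** Distributing the power gives one product for each word [f] of length [k]; words with the same
    letter counts give the same monomial. *)
Lemma multinomial_expansion (A : comPzSemiRingType) (x : 'I_n -> A) k N :
  (k < N)%N ->
  (\sum_(j < n) x j) ^+ k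
  = \sum_(a <- mbox n N) (multinom k a)%:R * \prod_(j < n) x j ^+ a j.
Proof.
move=> kN; rewrite -[in LHS](card_ord k) -prodr_const bigA_distr_bigA /=.
transitivity (\sum_(f : {ffun 'I_k -> 'I_n}) \sum_(a <- mbox n N)
    if mcount f == a then \prod_(j < n) x j ^+ a j else 0).
  apply: eq_bigr => f _; rewrite prod_mcount.
  have fN : mcount f \in mbox n N by rewrite mbox_mdeg// mdeg_mcount.
  rewrite (big_fsetD1 _ fN) /= eqxx [X in _ + X]big_seq [X in _ + X]big1 ?addr0// => a.
  by rewrite !inE eq_sym => /andP[/negbTE ->].
rewrite exchange_big /=; apply: eq_bigr => a _.
by rewrite -big_mkcond /= sumr_const mulr_natl.
Qed.

End Multinomial.

(** * The upper bound: polynomials in the sum of the coordinates *)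

Section UpperBound.
Variables (R : realType) (n : nat).
Implicit Types (a : multiindex n) (z : 'rV[R[i]]_n).

(* Coefficients of [P (z_1 + .. + z_n)] for [P = \sum_(k < K) b k * w ^ k]. *)
Definition radial_coef K (b : nat -> R) a : R[i] :=
  (\sum_(k < K) b k * (multinom k a)%:R)%:C.

Lemma radial_coefE K b a : (mdeg a < K)%N ->
  radial_coef K b a = (b (mdeg a) * (multinom (mdeg a) a)%:R)%:C.
Proof.
move=> aK; congr (_%:C); rewrite (bigD1 (Ordinal aK))//= big1 ?addr0// => k ka.
by rewrite multinom_eq0 ?mulr0// eq_sym; apply: contra ka => /eqP h; apply/eqP/val_inj.
Qed.

Lemma radial_coef_out K b a : (K <= mdeg a)%N -> radial_coef K b a = 0.
Proof.
move=> aK; rewrite /radial_coef big1// => k _.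
by rewrite multinom_eq0 ?mulr0// gtn_eqF// (leq_trans _ aK).
Qed.

Lemma net_sum_radial K b z :
  net_sum (fun a => radial_coef K b a * monomial z a)
    (\sum_(k < K) (b k)%:C * (\sum_(j < n) z 0 j) ^+ k).
Proof.
have -> : \sum_(k < K) (b k)%:C * (\sum_(j < n) z 0 j) ^+ k
    = \sum_(a <- mbox n K) radial_coef K b a * monomial z a.
  rewrite (eq_bigr (fun k : 'I_K => \sum_(a <- mbox n K)
      (b k)%:C * (multinom k a)%:R * monomial z a)).
    rewrite exchange_big /=; apply: eq_bigr => a _.
    rewrite /radial_coef rmorph_sum mulr_suml; apply: eq_bigr => k _ /=.
    by rewrite rmorphM rmorph_nat.
  move=> k _; rewrite (multinomial_expansion _ (ltn_ord k)) mulr_sumr.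
  by apply: eq_bigr => a _; rewrite mulrA.
apply: net_sum_finite => a aK; rewrite radial_coef_out ?mul0r//.
by rewrite leqNgt; apply: contra aK; exact: mbox_mdeg.
Qed.

Lemma msup_ge a : (mdeg a)%:R^-1 ^+ mdeg a <= msup R a.
Proof.
rewrite -prod_pow_mdeg; apply: ler_prod => j _.
rewrite exprn_ge0 ?invr_ge0//=.
have [->|aj] := posnP (a j); first by rewrite !expr0.
rewrite lerXn2r ?nnegrE ?invr_ge0 ?divr_ge0//.
by rewrite ler_peMl ?invr_ge0// ler1n.
Qed.

(** The multinomial coefficients of degree [k] add up to [n ^ k], and [msup_ge] supplies the factor
    [k^(-k)]. The term [k = 0] is [|b 0|], as the quotient by 0 is raised to the power 0. *)
Lemma sum_majorant_radial K (b : nat -> R) (r : R) : 0 <= r ->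
  \sum_(k < K) `|b k| * (r * n%:R / k%:R) ^+ k
  <= \sum_(a <- mbox n K) majorant (radial_coef K b) r a.
Proof.
move=> r0.
have -> : \sum_(k < K) `|b k| * (r * n%:R / k%:R) ^+ k
  = \sum_(a <- mbox n K) \sum_(k < K)
      `|b k| * (r / k%:R) ^+ k * (multinom k a)%:R.
  rewrite exchange_big /=; apply: eq_bigr => k _.
  rewrite -mulr_sumr mulrAC exprMn mulrA; congr (_ * _).
  have := @multinomial_expansion n R (fun=> 1) k K (ltn_ord k).
  rewrite sumr_const card_ord => ->; apply: eq_bigr => a _.
  by rewrite prod_pow_mdeg expr1n mulr1.
apply: ler_sum => a _; have [aK|aK] := ltnP (mdeg a) K; last first.
  rewrite big1 ?majorant_ge0// => k _.
  by rewrite multinom_eq0 ?mulr0// gtn_eqF// (leq_trans _ aK).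
rewrite (bigD1 (Ordinal aK))//= big1 ?addr0; last first.
  move=> k ka; rewrite multinom_eq0 ?mulr0// eq_sym.
  by apply: contra ka => /eqP h; apply/eqP/val_inj.
rewrite /majorant radial_coefE// cmod_real normrM normr_nat exprMn.
set B := `|b _|; set m := (multinom _ _)%:R; set t := _ ^-1 ^+ _.
rewrite [leLHS](_ : _ = B * m * r ^+ mdeg a * t); last by ring.
rewrite [leRHS]mulrAC ler_wpM2l ?msup_ge//.
by rewrite !mulr_ge0 ?exprn_ge0 ?ler0n ?normr_ge0.
Qed.

(** The squared moduli differ by [(1 - x^2) (1 - |w|^2)]. *)
Lemma cmod_blaschke_num (x : R) (w : R[i]) : 0 <= x -> x < 1 -> cmod w < 1 ->
  cmod (x%:C - w) < cmod (1 - x%:C * w).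
Proof.
move=> x0 x1 w1; rewrite -ltr_sqr ?nnegrE ?cmod_ge0// !sqr_cmod.
have : cmod w ^+ 2 < 1 by rewrite expr_lt1// cmod_ge0.
rewrite sqr_cmod; case: w {w1} => u v /= uv.
have x2 : 0 < 1 - x ^+ 2 by rewrite subr_gt0 expr_lt1.
have uv0 : 0 < 1 - (u ^+ 2 + v ^+ 2) by rewrite subr_gt0.
by have := mulr_gt0 x2 uv0; lra.
Qed.

(* Taylor coefficients at 0 of [(x - w) / (1 - x w)]. *)
Definition blaschke_coef (x : R) (k : nat) : R :=
  if k is k'.+1 then - (1 - x ^+ 2) * x ^+ k' else x.

(** The partial sum is the Blaschke quotient plus the remainder [(1 - x^2) w (x w)^K / (1 - x w)],
    whose modulus is at most [(1 + x) x^K] because [|1 - x w| >= 1 - x]. *)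
Lemma cmod_blaschke_partial (x : R) K (w : R[i]) : 0 <= x -> x < 1 ->
  cmod w < 1 ->
  cmod (\sum_(k < K.+1) (blaschke_coef x k)%:C * w ^+ k) < 1 + 2 * x ^+ K.
Proof.
move=> x0 x1 w1.
have D1 : 1 - x <= cmod (1 - x%:C * w).
  have := ler_cmodB 1 (- (x%:C * w)); rewrite cmod1 cmodN cmodM cmod_real ger0_norm//.
  by apply: le_trans; rewrite lerD2l lerN2 ler_piMr// ltW.
have D0 : 0 < cmod (1 - x%:C * w) by apply: lt_le_trans D1; rewrite subr_gt0.
have DN : 1 - x%:C * w != 0 by rewrite -cmod_eq0 gt_eqF.
have -> : \sum_(k < K.+1) (blaschke_coef x k)%:C * w ^+ k
    = (x%:C - w) / (1 - x%:C * w)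
      + (1 - x ^+ 2)%:C * w * (x%:C * w) ^+ K / (1 - x%:C * w).
  rewrite big_ord_recl /= expr0 mulr1.
  have -> : \sum_(i < K) (blaschke_coef x (bump 0 i))%:C * w ^+ bump 0 i
      = - (1 - x ^+ 2)%:C * w * \sum_(i < K) (x%:C * w) ^+ i.
    rewrite mulr_sumr; apply: eq_bigr => i _; rewrite /bump /= add1n.
    have -> : (blaschke_coef x i.+1)%:C = - (1 - x ^+ 2)%:C * x%:C ^+ i.
      by rewrite -rmorphXn -rmorphN -rmorphM.
    by rewrite [w ^+ i.+1]exprS exprMn; ring.
  have := subrX1 (x%:C * w) K; set S := \sum_(i < K) _ => hS.
  have -> : (x%:C * w) ^+ K = 1 - (1 - x%:C * w) * S.
    by rewrite -[LHS](subrK 1) hS; ring.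
  apply: (mulIf DN); rewrite !mulrDl !divfK//.
  have -> : (1 - x ^+ 2)%:C = 1 - x%:C ^+ 2.
    by rewrite -rmorphXn -(rmorph1 (real_complex R)) -rmorphB.
  by ring.
apply: le_lt_trans (ler_cmodD _ _) _; apply: ltr_leD.
  by rewrite cmodM cmodV ltr_pdivrMr// mul1r cmod_blaschke_num.
rewrite cmodM cmodV ler_pdivrMr//.
rewrite !cmodM cmodX cmodM !cmod_real (ger0_norm x0) ger0_norm; last by nra.
have xK : 0 <= x ^+ K by rewrite exprn_ge0.
have le1 : cmod w * (x * cmod w) ^+ K <= x ^+ K.
  rewrite exprMn mulrCA ler_piMr// mulr_ile1 ?exprn_ge0 ?cmod_ge0 ?(ltW w1)//.
  by rewrite exprn_ile1 ?cmod_ge0 ?ltW.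
rewrite -mulrA.
have x2 : 0 <= 1 - x ^+ 2 by nra.
apply: le_trans (ler_wpM2l x2 le1) _.
apply: le_trans (_ : 2 * x ^+ K * (1 - x) <= _); last by rewrite ler_wpM2l// mulr_ge0.
rewrite -subr_ge0 [leRHS](_ : _ = x ^+ K * (1 - x) ^+ 2); last by ring.
by rewrite mulr_ge0// sqr_ge0.
Qed.

Local Notation rho := ((446 * 10 ^+ 3 + 662) / 10 ^+ 6 : R).

Lemma limit_equation_excess :
  1 / 2 + 3 / 10 ^+ 7 <= rho + (rho / 2) ^+ 2 + (rho / 3) ^+ 3 + (rho / 4) ^+ 4
    + (rho / 5) ^+ 5.
Proof. by lra. Qed.

Lemma exists_expr_le (x e : R) : 0 <= x -> x < 1 -> 0 < e ->
  exists2 K, (5 <= K)%N & x ^+ K <= e.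
Proof.
move=> x0 x1 e0.
have /cvgrPdist_lt/(_ _ e0)[K _ hK] : (fun k => x ^+ k) @ \oo --> (0 : R).
  by apply: cvg_expr; rewrite ger0_norm.
exists (K + 5)%N; first by rewrite leq_addl.
have := hK (K + 5)%N (leq_addr _ _); rewrite /= sub0r normrN => /ltW.
by apply: le_trans; exact: ler_norm.
Qed.

Lemma bohr_upper (r : R) : (0 < n)%N -> 0 < r ->
  bohr_property (@hypercone R n) r -> r < rho / n%:R.
Proof.
move=> n0 r0 /(bohr_propertyP _ r0) hr; rewrite ltNge; apply/negP => le_r.
have rho_le : rho <= r * n%:R by rewrite -ler_pdivrMr ?ltr0n.
(* In the lower bound [x + m (1/2 + 3 d)] for [s] the terms of first order in [d] cancel; the excess
   [3 d] from [limit_equation_excess] contributes [6 d^2], against a loss of [9/2 d^2] at second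
   order. *)
pose d : R := 1 / 10 ^+ 7; pose x := 1 - d.
have x0 : 0 <= x by rewrite /x /d; lra.
have x1 : x < 1 by rewrite /x /d; lra.
pose t k : R := (rho / k%:R) ^+ k.
have rho0 : 0 <= rho by lra.
have t0 k : 0 <= t k := exprn_ge0 k (divr_ge0 rho0 (ler0n _ k)).
pose s := \sum_(k < 6) `|blaschke_coef x k| * t k.
have x2 : 0 <= 1 - x ^+ 2 by rewrite subr_ge0 exprn_ile1// ltW.
(* A common lower bound for the moduli of the coefficients of index 1 to 5, as [x^4 >= 1 - 4 d]. *)
pose m := (1 - x ^+ 2) * (1 - 4 * d).
have coef_ge k : (k <= 4)%N -> m <= `|blaschke_coef x k.+1|.
  move=> k4; rewrite normrM normrN (ger0_norm x2) (ger0_norm (exprn_ge0 _ x0)).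
  rewrite ler_wpM2l//; apply: le_trans (_ : x ^+ 4 <= _).
    by rewrite /x /d; lra.
  exact: ler_wiXn2l x0 (ltW x1) _ _ k4.
have s1 : 1 < s.
  have T : 1 / 2 + 3 / 10 ^+ 7 <= t 1%N + t 2%N + t 3%N + t 4%N + t 5%N.
    by have := limit_equation_excess; rewrite /t; lra.
  have num : 1 < x + m * (1 / 2 + 3 / 10 ^+ 7) by rewrite /m /x /d; lra.
  have m0 : 0 <= m by apply: mulr_ge0 x2 _; rewrite /d; lra.
  apply: lt_le_trans num _.
  apply: le_trans (_ : x + m * _ <= _).
    by rewrite lerD2l; exact: ler_wpM2l T.
  clearbody m; clearbody x.
  rewrite /s !big_ord_recl big_ord0 addr0 !mulrDr -!addrA; apply: lerD.
    by rewrite /t /= expr0 mulr1 ler_norm.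
  have term k : (k <= 4)%N -> m * t k.+1 <= `|blaschke_coef x k.+1| * t k.+1.
    by move=> k4; exact: ler_wpM2r (coef_ge _ k4).
  apply: lerD; first exact: (term 0%N).
  apply: lerD; first exact: (term 1%N).
  apply: lerD; first exact: (term 2%N).
  by apply: lerD; [exact: (term 3%N)|exact: (term 4%N)].
have [|K K5 hK] := @exists_expr_le x ((s - 1) / 2) x0 x1.
  by rewrite divr_gt0// subr_gt0.
have sK : 1 + 2 * x ^+ K <= s by lra.
(* Dividing by [D] brings the Taylor polynomial below 1 in modulus; since [D <= s], its majorant
   remains at least [s / D >= 1]. The condition [5 <= K] keeps all six terms of [s]. *)
pose D := 1 + 2 * x ^+ K.
have D0 : 0 < D by rewrite ltr_pwDl// mulr_ge0// exprn_ge0.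
pose b k := D^-1 * blaschke_coef x k.
have hc : schur (@radial_coef K.+1 b).
  move=> z Dz; exists (\sum_(k < K.+1) (b k)%:C * (\sum_(j < n) z 0 j) ^+ k).
    exact: net_sum_radial.
  set w := \sum_(j < n) _.
  have w1 : cmod w < 1 by apply: le_lt_trans (ler_cmod_sum _ _ _) Dz.
  rewrite (eq_bigr (fun k : 'I_K.+1 => D^-1%:C * ((blaschke_coef x k)%:C * w ^+ k))).
    rewrite -mulr_sumr cmodM cmod_real gtr0_norm ?invr_gt0// mulrC.
    by rewrite ltr_pdivrMr// mul1r cmod_blaschke_partial.
  by move=> k _; rewrite mulrA -rmorphM.
have := esum_ltW (hr _ hc) (mbox n K.+1); rewrite ltNge => /negP; apply.
apply: le_trans (sum_majorant_radial _ _ (ltW r0)).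
rewrite -(big_mkord predT (fun k => `|b k| * (r * n%:R / k%:R) ^+ k)).
rewrite (@big_cat_nat _ _ _ 6)//= -[leLHS]addr0; apply: lerD; last first.
  apply: sumr_ge0 => k _; apply: mulr_ge0 (normr_ge0 _) (exprn_ge0 _ _).
  by apply: divr_ge0 (ler0n _ _); apply: mulr_ge0 (ltW r0) (ler0n _ _).
apply: le_trans (_ : D^-1 * s <= _).
  by rewrite mulrC ler_pdivlMr// mul1r.
rewrite big_mkord /s mulr_sumr; apply: ler_sum => k _.
rewrite /b normrM gtr0_norm ?invr_gt0// -[leRHS]mulrA; apply: ler_wpM2l.
  by rewrite invr_ge0 ltW.
apply: (ler_wpM2l (normr_ge0 _)); apply: lerXn2r.
- exact: divr_ge0 rho0 (ler0n _ _).
- by apply: divr_ge0 (ler0n _ _); apply: mulr_ge0 (ltW r0) (ler0n _ _).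
by apply: ler_wpM2r rho_le; rewrite invr_ge0 ler0n.
Qed.

End UpperBound.

(** * The Cauchy square of a coefficient family *)

Section Convolution.
Variable n : nat.
Implicit Types (a b : multiindex n).

(** The coefficient at [a] of the square of the series; the box holds all solutions of
    [madd b d = a], and any larger box gives the same value ([mconv_mbox]). *)
Definition mconv (A : pzSemiRingType) (u : multiindex n -> A) a : A :=
  \sum_(b <- mbox n (mdeg a).+1) \sum_(d <- mbox n (mdeg a).+1)
    if madd b d == a then u b * u d else 0.

Lemma mconv_mbox (A : pzSemiRingType) (u : multiindex n -> A) a N :
  (mdeg a < N)%N ->
  mconv u a = \sum_(b <- mbox n N) \sum_(d <- mbox n N)
    if madd b d == a then u b * u d else 0.
Proof.
move=> aN; have sub := mbox_sub n aN.
have out b d : b \notin mbox n (mdeg a).+1 -> madd b d == a = false.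
  move=> h; apply: contraNF h => /eqP <-; apply: mbox_mdeg.
  by rewrite ltnS mdegD leq_addr.
rewrite (big_fsubset _ sub) [X in _ = _ + X]big_seq [X in _ = _ + X]big1 ?addr0.
  apply: eq_bigr => b _.
  rewrite (big_fsubset _ sub) [X in _ = _ + X]big_seq [X in _ = _ + X]big1 ?addr0//.
  by move=> d; rewrite inE => /andP[dN _]; rewrite maddC out.
move=> b; rewrite inE => /andP[bN _]; rewrite big1// => d _.
by rewrite out.
Qed.

Lemma sum_mconv (A : pzSemiRingType) (u g : multiindex n -> A)
    (F : {fset multiindex n}) N :
  (forall a, a \in F -> mdeg a < N)%N ->
  \sum_(a <- F) mconv u a * g a
  = \sum_(b <- mbox n N) \sum_(d <- mbox n N)
      if madd b d \in F then u b * u d * g (madd b d) else 0.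
Proof.
move=> FN.
transitivity (\sum_(a <- F) \sum_(b <- mbox n N) \sum_(d <- mbox n N)
    if madd b d == a then u b * u d * g a else 0).
  rewrite big_seq [RHS]big_seq; apply: eq_bigr => a /FN aN.
  rewrite (mconv_mbox _ aN) mulr_suml; apply: eq_bigr => b _.
  rewrite mulr_suml; apply: eq_bigr => d _.
  by case: ifP; rewrite ?mul0r.
rewrite exchange_big /=; apply: eq_bigr => b _.
rewrite exchange_big /=; apply: eq_bigr => d _.
case: ifPn => bd.
  rewrite (big_fsetD1 _ bd) /= eqxx [X in _ + X]big_seq [X in _ + X]big1 ?addr0//.
  by move=> a; rewrite !inE eq_sym => /andP[/negbTE ->].
rewrite big_seq big1// => a aF; case: eqP => // h.
by move: bd; rewrite h aF.
Qed.

End Convolution.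

(** * Convergence of the squared series *)

Section Product.
Variables (R : realType) (n : nat).
Implicit Types (a b : multiindex n).

Lemma fsub_mdeg (F : {fset multiindex n}) :
  exists N, forall a, a \in F -> (mdeg a < N)%N.
Proof.
exists (\max_(a <- F) mdeg a).+1 => a aF.
by rewrite ltnS; exact: leq_bigmax_seq.
Qed.

Lemma ler_cmod_mconv (u : multiindex n -> R[i]) a :
  cmod (mconv u a) <= mconv (fun b => cmod (u b)) a.
Proof.
apply: le_trans (ler_cmod_sum _ _ _) _; apply: ler_sum => b _.
apply: le_trans (ler_cmod_sum _ _ _) _; apply: ler_sum => d _.
by case: ifP => _; [rewrite cmodM lexx|rewrite cmod0 lexx].
Qed.

Lemma big_mbox_indicator (A : pzSemiRingType) (p : multiindex n -> A)
    (F : {fset multiindex n}) N : (F `<=` mbox n N)%fset ->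
  \sum_(b <- F) p b = \sum_(b <- mbox n N) if b \in F then p b else 0.
Proof.
move=> FN; rewrite [RHS](big_fsubset _ FN) [X in _ = _ + X]big_seq.
rewrite [X in _ = _ + X]big1 ?addr0.
  by rewrite big_seq [RHS]big_seq; apply: eq_bigr => b ->.
by move=> b; rewrite inE => /andP[/negbTE ->].
Qed.

(** Once [F] contains all sums of two elements of [F0], its partial sum differs from [Y ^+ 2] only
    by pairs not both in [F0]; in modulus these add up to at most [X' ^+ 2 - Y' ^+ 2], which the
    tail bound controls. *)
Lemma net_sum_mconv (u : multiindex n -> R[i]) (z : 'rV[R[i]]_n) s :
  net_sum (fun a => u a * monomial z a) s ->
  net_sum (fun a => mconv u a * monomial z a) (s ^+ 2).
Proof.
move=> hs; pose p a := u a * monomial z a.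
have [C hC] := net_sum_bounded hs.
have C0 : 0 <= C by have := hC fset0; rewrite big_seq_fset0.
(* The total error is at most [eta (4 C + eta)], which is below [e] because [eta <= 1]. *)
move=> e e0; pose eta := e / (4 * C + 2 + e).
have D0 : 0 < 4 * C + 2 + e by lra.
have eta0 : 0 < eta by rewrite divr_gt0.
have eta1 : eta <= 1 by rewrite ler_pdivrMr// mul1r; lra.
have etaE : eta * (4 * C + 2 + e) = e by rewrite divfK// gt_eqF.
have [F0 tail] := net_sum_tail hs eta0.
pose F1 := [fset madd bd.1 bd.2 | bd in (F0 `*` F0)%fset]%fset.
exists F1 => F F1F.
have [N FN] := fsub_mdeg (F `|` F0)%fset.
have F0N : (F0 `<=` mbox n N)%fset.
  by apply/fsubsetP => a aF; apply: mbox_mdeg; apply: FN; rewrite inE aF orbT.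
have sumE : \sum_(a <- F) mconv u a * monomial z a
    = \sum_(b <- mbox n N) \sum_(d <- mbox n N)
        if madd b d \in F then p b * p d else 0.
  rewrite (@sum_mconv _ _ _ _ _ N); last by move=> a aF; apply: FN; rewrite inE aF.
  apply: eq_bigr => b _; apply: eq_bigr => d _; case: ifP => // _.
  by rewrite monomialD /p mulrACA.
pose Y := \sum_(b <- F0) p b.
have YE : Y ^+ 2 = \sum_(b <- mbox n N) \sum_(d <- mbox n N)
    if (b \in F0) && (d \in F0) then p b * p d else 0.
  rewrite /Y (big_mbox_indicator _ F0N) expr2 mulr_suml; apply: eq_bigr => b _.
  rewrite mulr_sumr; apply: eq_bigr => d _.
  by case: (b \in F0); case: (d \in F0); rewrite ?(mul0r, mulr0).
pose X' := \sum_(b <- mbox n N) cmod (p b).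
pose Y' := \sum_(b <- F0) cmod (p b).
have YX' : X' - Y' <= eta.
  rewrite /X' (big_fsubset _ F0N) addrC addKr; apply: tail.
  by apply/fdisjointP => b; rewrite inE => /andP[].
have Y'0 : 0 <= Y' by apply: sumr_ge0 => b _; exact: cmod_ge0.
have X'C : X' <= C := hC _.
have Y'X' : Y' <= X' by apply: ler_sum_fsubset F0N => b; exact: cmod_ge0.
have dist1 : cmod (\sum_(a <- F) mconv u a * monomial z a - Y ^+ 2)
    <= X' ^+ 2 - Y' ^+ 2.
  have -> : X' ^+ 2 - Y' ^+ 2 = \sum_(b <- mbox n N) \sum_(d <- mbox n N)
      if (b \in F0) && (d \in F0) then 0 else cmod (p b) * cmod (p d).
    rewrite /Y' (big_mbox_indicator _ F0N) !expr2 /X' !mulr_suml -sumrB.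
    apply: eq_bigr => b _; rewrite !mulr_sumr -sumrB; apply: eq_bigr => d _.
    by case: (b \in F0); case: (d \in F0); rewrite ?(mul0r, mulr0, subr0, subrr).
  rewrite sumE YE -sumrB; apply: le_trans (ler_cmod_sum _ _ _) _.
  apply: ler_sum => b _; rewrite -sumrB; apply: le_trans (ler_cmod_sum _ _ _) _.
  apply: ler_sum => d _.
  case: (boolP ((b \in F0) && (d \in F0))) => [/andP[bF dF]|_].
    rewrite ifT ?subrr ?cmod0//; apply: (fsubsetP F1F).
    by apply/imfsetP; exists (b, d) => //=; rewrite !inE bF dF.
  by case: ifP => _; rewrite subr0; [rewrite cmodM lexx|rewrite cmod0 mulr_ge0 ?cmod_ge0].
have dist2 : cmod (s - Y) <= eta.
  exact: (net_sum_approx (fun=> lexx _) hs hs tail).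
have YC : cmod Y <= C by apply: le_trans (ler_cmod_sum _ _ _) (hC _).
have dist3 : cmod (Y ^+ 2 - s ^+ 2) <= eta * (2 * C + eta).
  have -> : Y ^+ 2 - s ^+ 2 = - ((s - Y) * (s - Y + Y + Y)) by ring.
  rewrite cmodN cmodM ler_pM ?cmod_ge0//.
  apply: le_trans (ler_cmodD _ _) _.
  have := ler_cmodD (s - Y) Y; lra.
have -> : \sum_(a <- F) mconv u a * monomial z a - s ^+ 2
    = (\sum_(a <- F) mconv u a * monomial z a - Y ^+ 2) + (Y ^+ 2 - s ^+ 2) by ring.
apply: le_lt_trans (ler_cmodD _ _) _.
apply: le_lt_trans (lerD dist1 dist3) _.
have : X' ^+ 2 - Y' ^+ 2 <= eta * (2 * C).
  rewrite subr_sqr ler_pM ?subr_ge0 ?addr_ge0//; first exact: le_trans Y'X'.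
  by lra.
by nra.
Qed.

End Product.

(** * Perturbing a function whose majorant sum equals 1 *)

Section Perturbation.
Variables (R : realType) (n : nat) (c : multiindex n -> R[i]) (x : R).
Hypotheses (schur_c : schur c) (c0 : c (mi0 n) = x%:C) (x0 : 0 <= x).
Implicit Types (a b d : multiindex n).

Let x1 : x < 1.
Proof. by have := schur_coef0 schur_c; rewrite c0 cmod_real ger0_norm. Qed.

Definition tail_coef a : R[i] := if a == mi0 n then 0 else c a.

Let kappa : R := 1 - ((1 - x) + (1 - x) ^+ 2 / 10) / 4.
Let lambda : R := (1 + (1 - x) / 5) / 4.

(* Coefficients of [1 - (u + u^2 / 10) / 4], where [u = 1 - f]; the constants
   [kappa] and [lambda] come from expanding in powers of [f - x = 1 - x - u]. *)
Definition perturbed_coef a : R[i] :=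
  (if a == mi0 n then kappa%:C else 0) + lambda%:C * tail_coef a
  + (- (1 / 40))%:C * mconv tail_coef a.

Lemma net_sum_delta (k : R[i]) (z : 'rV[R[i]]_n) :
  net_sum (fun a => (if a == mi0 n then k else 0) * monomial z a) k.
Proof.
have := @net_sum_finite R _
  (fun a => (if a == mi0 n then k else 0) * monomial z a) [fset mi0 n]%fset.
rewrite big_seq_fset1 eqxx monomial0 mulr1; apply => a.
by rewrite inE => /negbTE ->; rewrite mul0r.
Qed.

(** For [v = a + i b] the hypothesis says [|v|^2 < 2 a], whence [0 < a < 2]. With [V = v + v^2 / 10]
    the claim is [|V|^2 < 8 Re V]; here [|V|^2 < 4 a], while [8 Re V > 6 a]. *)
Lemma cmod_perturbed (v : R[i]) : cmod (1 - v) < 1 ->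
  cmod (1 - (v + v ^+ 2 * (1 / 10)%:C) * (1 / 4)%:C) < 1.
Proof.
move=> h; rewrite -(expr_lt1 (_ : (0 < 2)%N)) ?cmod_ge0// sqr_cmod.
have : cmod (1 - v) ^+ 2 < 1 by rewrite expr_lt1// cmod_ge0.
rewrite sqr_cmod; case: v {h} => a b /= h.
have hv : a ^+ 2 + b ^+ 2 < 2 * a by nra.
have b2 := sqr_ge0 b; have aa := sqr_ge0 a.
have a0 : 0 < a by nra.
have a2 : a < 2 by nra.
have p1 : (a ^+ 2 + b ^+ 2) * (1 + a / 5 + (a ^+ 2 + b ^+ 2) / 100) < 4 * a.
  have : 1 + a / 5 + (a ^+ 2 + b ^+ 2) / 100 < 2 by lra.
  by nra.
by lra.
Qed.

Lemma schur_perturbed : schur perturbed_coef.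
Proof.
move=> z Dz; have [s hs s1] := schur_c Dz.
have hv : net_sum (fun a => tail_coef a * monomial z a) (s - x%:C).
  apply: net_sum_ext (net_sumD hs (net_sum_delta (- x%:C) z)) => a.
  rewrite /tail_coef -mulrDl; case: eqP => [->|_]; rewrite ?addr0//.
  by rewrite c0 subrr.
exists (kappa%:C + lambda%:C * (s - x%:C) + (- (1 / 40))%:C * (s - x%:C) ^+ 2).
  apply: net_sum_ext (net_sumD (net_sumD (net_sum_delta kappa%:C z)
    (net_sumZ lambda%:C hv)) (net_sumZ (- (1 / 40))%:C (net_sum_mconv hv))) => a.
  by rewrite /perturbed_coef /=; ring.
have -> : kappa%:C + lambda%:C * (s - x%:C) + (- (1 / 40))%:C * (s - x%:C) ^+ 2
    = 1 - ((1 - s) + (1 - s) ^+ 2 * (1 / 10)%:C) * (1 / 4)%:C.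
  rewrite /kappa /lambda; case: s {hs s1 hv} => p q.
  by apply/eqP; rewrite eq_complex /=; apply/andP; split; apply/eqP; field.
by apply: cmod_perturbed; rewrite opprB addrC subrK.
Qed.

Variable r : R.
Hypothesis r0 : 0 < r.

Let w a : R := msup R a * r ^+ mdeg a.

Let w0 a : 0 < w a.
Proof. by rewrite mulr_gt0 ?msup_gt0// exprn_gt0. Qed.

Lemma weightD_le a b : w (madd a b) <= w a * w b.
Proof.
rewrite /w mdegD exprD mulrACA ler_wpM2r ?msupD_le//.
by rewrite mulr_ge0// exprn_ge0// ltW.
Qed.

Lemma perturbed_coef_ge a :
  (if a == mi0 n then kappa else 0) + lambda * cmod (tail_coef a)
  - 1 / 40 * mconv (fun b => cmod (tail_coef b)) a <= cmod (perturbed_coef a).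
Proof.
have x1' := x1; have x0' := x0.
have k0 : 0 <= kappa.
  have : (1 - x) ^+ 2 <= 1 by rewrite expr_le1//; lra.
  by rewrite /kappa; lra.
have l0 : 0 <= lambda by rewrite /lambda; lra.
have le40 : cmod ((- (1 / 40))%:C * mconv tail_coef a)
    <= 1 / 40 * mconv (fun b => cmod (tail_coef b)) a.
  rewrite cmodM cmod_real normrN ger0_norm// ler_wpM2l//.
  exact: ler_cmod_mconv.
apply: le_trans (ler_cmodB _ _); rewrite lerB//.
rewrite /tail_coef; case: eqP => _.
  by rewrite cmod0 !mulr0 !addr0 cmod_real ger0_norm.
by rewrite !add0r cmodM cmod_real ger0_norm.
Qed.

(** Submultiplicativity of the weights alone gives the value [kappa + lambda (1 - x) - (1 - x)^2 /
    40 = 1]. The strict inequality at the pair [b0], [d0] lowers the subtracted quadratic term by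
    [delta / 40]. *)
Lemma perturbed_majorant_gt1 b0 d0 :
  (forall F : {fset multiindex n}, \sum_(a <- F) majorant c r a <= 1) ->
  (forall eta, 0 < eta -> exists F : {fset multiindex n},
     1 - eta < \sum_(a <- F) majorant c r a) ->
  b0 != mi0 n -> d0 != mi0 n -> c b0 != 0 -> c d0 != 0 ->
  msup R (madd b0 d0) < msup R b0 * msup R d0 ->
  exists F : {fset multiindex n}, 1 < \sum_(a <- F) majorant perturbed_coef r a.
Proof.
move=> le1 near1 b00 d00 cb0 cd0 ms; have x1' := x1; have x0' := x0.
pose m a := cmod (tail_coef a) * w a.
have m0 a : 0 <= m a by rewrite mulr_ge0 ?cmod_ge0// ltW.
have majE a : majorant c r a = (if a == mi0 n then x else 0) + m a.
  rewrite /majorant /m /tail_coef -mulrA -/(w a); case: eqP => [->|_].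
    rewrite cmod0 mul0r addr0 c0 cmod_real ger0_norm//.
    by rewrite /w msup0 mdeg0 expr0 !mulr1.
  by rewrite add0r.
have sumE (F : {fset multiindex n}) : mi0 n \in F ->
    \sum_(a <- F) majorant c r a = x + \sum_(a <- F) m a.
  move=> F0; under eq_bigr do rewrite majE.
  rewrite big_split /=; congr (_ + _).
  rewrite (big_fsetD1 _ F0) /= eqxx [X in _ + X]big_seq [X in _ + X]big1 ?addr0//.
  by move=> a; rewrite !inE => /andP[/negbTE ->].
pose delta := cmod (c b0) * cmod (c d0) * (w b0 * w d0 - w (madd b0 d0)).
have delta0 : 0 < delta.
  apply: mulr_gt0; first by apply: mulr_gt0; rewrite lt_def cmod_ge0 cmod_eq0 ?cb0 ?cd0.
  rewrite subr_gt0 /w mdegD exprD mulrACA ltr_pM2r//.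
  by rewrite mulr_gt0// exprn_gt0.
have lambda1 : lambda < 1 by rewrite /lambda; lra.
(* With this tolerance the truncation loses only [lambda * delta / 40], less than the gain
   [delta / 40] since [lambda < 1]. *)
have [F1 hF1] := near1 (delta / 40) (divr_gt0 delta0 (ltr0n _ 40)).
pose F := (mi0 n |` F1)%fset; exists F.
have F0 : mi0 n \in F by rewrite !inE eqxx.
have hF : 1 - x - delta / 40 < \sum_(a <- F) m a.
  have : \sum_(a <- F1) majorant c r a <= \sum_(a <- F) majorant c r a.
    apply: ler_sum_fsubset (fsubsetUr _ _) => a.
    exact: majorant_ge0 (ltW r0).
  by rewrite (sumE _ F0); lra.
have [N hN] := fsub_mdeg ([fset b0; d0] `|` F)%fset.
have FN a : a \in F -> (mdeg a < N)%N by move=> aF; apply: hN; rewrite in_fsetU aF orbT.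
have bN : b0 \in mbox n N by apply: mbox_mdeg; apply: hN; rewrite !inE eqxx.
have dN : d0 \in mbox n N by apply: mbox_mdeg; apply: hN; rewrite !inE eqxx orbT.
have zN : mi0 n \in mbox n N by apply: mbox_mdeg; apply: FN.
pose X := \sum_(a <- mbox n N) m a.
have X0 : 0 <= X by apply: sumr_ge0 => a _.
have X1 : X <= 1 - x by have := le1 (mbox n N); rewrite (sumE _ zN) -/X; lra.
pose t b d := cmod (tail_coef b) * cmod (tail_coef d) * w (madd b d).
have tm b d : t b d <= m b * m d.
  rewrite /t /m [leRHS]mulrACA ler_wpM2l ?weightD_le//.
  by rewrite mulr_ge0 ?cmod_ge0.
have conv_le : \sum_(a <- F) mconv (fun b => cmod (tail_coef b)) a * w a
    <= X ^+ 2 - delta.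
  rewrite (sum_mconv _ _ FN).
  apply: le_trans (_ : \sum_(b <- mbox n N) \sum_(d <- mbox n N)
      (m b * m d - (if (b == b0) && (d == d0) then delta else 0)) <= _).
    apply: ler_sum => b _; apply: ler_sum => d _.
    have [/andP[/eqP -> /eqP ->]|_] := boolP ((b == b0) && (d == d0)).
      have -> : m b0 * m d0 - delta = t b0 d0.
        by rewrite /m /t /delta /tail_coef (negbTE b00) (negbTE d00); ring.
      case: ifP => _; first exact: lexx.
      exact: mulr_ge0 (mulr_ge0 (cmod_ge0 _) (cmod_ge0 _)) (ltW (w0 _)).
    by rewrite subr0; case: ifP => _; [exact: tm|rewrite mulr_ge0].
  rewrite (eq_bigr (fun b => m b * X - (if b == b0 then delta else 0))).
    rewrite sumrB -mulr_suml -/X -expr2 lerD2l lerN2.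
    rewrite (big_fsetD1 _ bN) /= eqxx lerDl; apply: sumr_ge0 => b _.
    by case: ifP => // _; exact: ltW.
  move=> b _; rewrite sumrB -mulr_sumr; congr (_ - _).
  case: (b == b0); last by rewrite big1.
  rewrite (big_fsetD1 _ dN) /= eqxx [X in _ + X]big_seq [X in _ + X]big1 ?addr0//.
  by move=> d; rewrite !inE => /andP[/negbTE ->].
have : \sum_(a <- F) (((if a == mi0 n then kappa else 0) + lambda * cmod (tail_coef a)
    - 1 / 40 * mconv (fun b => cmod (tail_coef b)) a) * w a)
    <= \sum_(a <- F) majorant perturbed_coef r a.
  apply: ler_sum => a _.
  have -> : majorant perturbed_coef r a = cmod (perturbed_coef a) * w a.
    by rewrite /w mulrA.
  by rewrite ler_wpM2r ?perturbed_coef_ge// ltW.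
have -> : \sum_(a <- F) (((if a == mi0 n then kappa else 0)
      + lambda * cmod (tail_coef a)
      - 1 / 40 * mconv (fun b => cmod (tail_coef b)) a) * w a)
    = kappa + lambda * \sum_(a <- F) m a
      - 1 / 40 * \sum_(a <- F) mconv (fun b => cmod (tail_coef b)) a * w a.
  rewrite (eq_bigr (fun a => (if a == mi0 n then kappa else 0) * w a
      + lambda * m a - 1 / 40 * (mconv (fun b => cmod (tail_coef b)) a * w a))).
    rewrite sumrB big_split /= -!mulr_sumr; congr (_ + _ - _).
    rewrite (big_fsetD1 _ F0) /= eqxx [X in _ + X]big_seq [X in _ + X]big1 ?addr0.
      by rewrite /w msup0 mdeg0 expr0 !mulr1.
    by move=> a; rewrite !inE => /andP[/negbTE ->]; rewrite mul0r.
  move=> a _; rewrite mulrBl mulrDl; congr (_ + _ - _); exact/esym/mulrA.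
move=> le_h; apply: lt_le_trans le_h.
have l0 : 0 < lambda by rewrite /lambda; lra.
have XX : X ^+ 2 <= (1 - x) ^+ 2 by rewrite ler_sqr ?nnegrE// subr_ge0 ltW.
have lo : lambda * (1 - x - delta / 40) < lambda * \sum_(a <- F) m a.
  by rewrite ltr_pM2l.
have ld : lambda * delta < delta by rewrite gtr_pMl.
apply: lt_le_trans (_ : kappa + lambda * (1 - x - delta / 40)
   - 1 / 40 * ((1 - x) ^+ 2 - delta) <= _); last first.
  by lra.
have -> : kappa + lambda * (1 - x - delta / 40) - 1 / 40 * ((1 - x) ^+ 2 - delta)
  = 1 + (delta - lambda * delta) / 40 by rewrite /kappa /lambda; field.
by lra.
Qed.

End Perturbation.

(** * The supremum of the admissible radii is admissible *)

Section Attained.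
Variables (R : realType) (n : nat) (B : R).
Hypotheses (B0 : 0 < B) (B3 : B < 1 / 3).
Hypothesis below : forall r, 0 < r -> r < B -> bohr_property (@hypercone R n) r.
Implicit Types (a b : multiindex n) (c : multiindex n -> R[i]).

Lemma majorant_dilate_ge c t K a : 0 <= t -> t <= 1 -> (mdeg a <= K)%N ->
  t ^+ K * majorant c B a <= majorant c (t * B) a.
Proof.
move=> t0 t1 aK; rewrite /majorant exprMn [leRHS]mulrCA ler_wpM2r//.
  exact: majorant_ge0 (ltW B0).
exact: ler_wiXn2l aK.
Qed.

(** A finite majorant sum is continuous in the radius: if it exceeded 1 at [B], it would be at least
    1 at some [t * B < B], against admissibility there. *)
Lemma sum_majorant_le1 c (F : {fset multiindex n}) : schur c ->
  \sum_(a <- F) majorant c B a <= 1.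
Proof.
move=> hc; rewrite leNgt; apply/negP; set S := \sum_(a <- F) _ => S1.
have [K FK] := fsub_mdeg F.
(* The positive exponent [K.+1] excludes [t = 0] in [tS]. *)
have [|t [t0 t1 le_t]] := @approx_expr R S K.+1 (S - 1) (ltW (lt_trans ltr01 S1)).
  by rewrite subr_gt0.
have tS : 1 <= t ^+ K.+1 * S by lra.
have t_gt0 : 0 < t.
  by rewrite lt_def t0 andbT; apply/eqP => h; move: tS; rewrite h exprS !mul0r ler10.
have tB : t * B < B by rewrite gtr_pMl.
have := bohr_propertyP n (mulr_gt0 t_gt0 B0).
move=> /iffLR/(_ (below (mulr_gt0 t_gt0 B0) tB) _ hc)/esum_ltW/(_ F).
rewrite ltNge => /negP; apply; apply: le_trans tS _.
rewrite mulr_sumr big_seq [leRHS]big_seq; apply: ler_sum => a aF.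
by apply: majorant_dilate_ge; rewrite ?(ltW t1)// ltnW// ltnW// ltnS FK.
Qed.

(** Each positive degree occurs at most once, so the sum is dominated by [B + B^2 + ...]. *)
Lemma sum_geometric_inj (F : {fset multiindex n}) :
  mi0 n \notin F -> {in F &, injective (@mdeg n)} ->
  \sum_(a <- F) B ^+ mdeg a <= B / (1 - B).
Proof.
move=> F0 inj; have [K FK] := fsub_mdeg F.
have B1 : 0 < 1 - B by have := B3; lra.
apply: le_trans (_ : \sum_(k < K) B ^+ k.+1 <= _); last first.
  rewrite ler_pdivlMr//; under eq_bigr do rewrite exprS.
  rewrite -mulr_sumr -mulrA ler_piMr ?(ltW B0)// mulrC.
  have -> : (1 - B) * \sum_(k < K) B ^+ k = 1 - B ^+ K.
    by rewrite -[1 - B ^+ K]opprB subrX1 -mulNr opprB.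
  by rewrite gerBl exprn_ge0// ltW.
apply: le_trans (_ : \sum_(a <- F) \sum_(k < K)
    (if mdeg a == k.+1 then B ^+ k.+1 else 0) <= _).
  rewrite big_seq [leRHS]big_seq; apply: ler_sum => a aF.
  have da : (0 < mdeg a)%N by rewrite mdeg_gt0; apply: contraNneq F0 => <-.
  have dK : ((mdeg a).-1 < K)%N by rewrite prednK// ltnW// FK.
  rewrite (bigD1 (Ordinal dK))//= prednK// eqxx lerDl.
  by apply: sumr_ge0 => k _; case: ifP => // _; rewrite exprn_ge0// ltW.
rewrite exchange_big /=; apply: ler_sum => k _.
have [[a aF ak]|no] := pselect (exists2 a, a \in F & mdeg a = k.+1).
  rewrite (big_fsetD1 _ aF) /= ak eqxx [X in _ + X]big_seq [X in _ + X]big1 ?addr0//.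
  move=> b; rewrite !inE => /andP[ba bF]; case: eqP => // bk.
  by move: ba; rewrite (inj b a)// ?bk ?ak// eqxx.
rewrite big_seq big1 ?exprn_ge0 ?(ltW B0)// => a aF.
by case: eqP => // ak; case: no; exists a.
Qed.

Lemma bohr_attained : bohr_property (@hypercone R n) B.
Proof.
apply/(bohr_propertyP _ B0) => c0 /schur_normalize[c [hc cE maj]].
rewrite -(eq_esum (fun a _ => congr1 EFin (maj B a))).
have x0 := cmod_ge0 (c0 (mi0 n)); move: cE x0; set x := cmod _ => cE x0.
have x1 : x < 1 by have := schur_coef0 hc; rewrite cE cmod_real ger0_norm.
rewrite ltNge; apply/negP => ge1.
have near1 eta : 0 < eta -> exists F : {fset multiindex n},
    1 - eta < \sum_(a <- F) majorant c B a.
  move=> eta0; apply/not_existsP => no.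
  have : (\esum_(a in [set: multiindex n]) (majorant c B a)%:E < 1)%E.
    apply: (@esum_lt_bound _ _ _ (1 - eta)); last by rewrite gtrBl.
    by move=> F; rewrite leNgt; apply/negP; exact: no.
  by rewrite ltNge ge1.
have [[b [d [b0 d0 cb cd lt_bd]]]|no] := pselect (exists b d,
    [/\ b != mi0 n, d != mi0 n, c b != 0, c d != 0
      & msup R (madd b d) < msup R b * msup R d]).
  have [F] := perturbed_majorant_gt1 hc cE x0 B0
    (fun F => sum_majorant_le1 F hc) near1 b0 d0 cb cd lt_bd.
  by rewrite ltNge sum_majorant_le1//; exact: schur_perturbed.
(* All exponents of nonzero coefficients lie on one ray, so they are determined
   by their degrees and the one-variable estimate applies. *)
have inj b d : b != mi0 n -> d != mi0 n -> c b != 0 -> c d != 0 ->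
    mdeg b = mdeg d -> b = d.
  move=> b0 d0 cb cd bd; apply/ffunP => j; apply/eqP; apply: contrapT => /negP jN.
  apply: no; exists b, d; split => //; apply: (@msupD_lt _ _ _ _ j) => //.
  by rewrite bd eqn_pmul2r ?mdeg_gt0// eq_sym.
have B1 : 0 < 1 - B by have := B3; lra.
(* The one-variable bound; it is below 1 because [B < 1/3] means [B / (1 - B) < 1/2]. *)
pose y := x + 2 * (1 - x) * (B / (1 - B)).
have y1 : y < 1.
  have : B / (1 - B) < 1 / 2 by rewrite ltr_pdivrMr//; have := B3; lra.
  by rewrite /y; nra.
have : (\esum_(a in [set: multiindex n]) (majorant c B a)%:E < 1)%E.
  apply: esum_lt_bound y1 => F.
  pose G := [fset a in F | (a != mi0 n) && (c a != 0)]%fset.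
  apply: le_trans (_ : \sum_(a <- (mi0 n |` F)%fset) majorant c B a <= _).
    apply: ler_sum_fsubset (fsubsetUr _ _) => a.
    exact: majorant_ge0 (ltW B0).
  rewrite (big_fsetD1 (mi0 n)) ?inE ?eqxx//=; apply: lerD.
    by rewrite /majorant cE cmod_real ger0_norm// msup0 mdeg0 expr0 !mulr1.
  have GF : (G `<=` (mi0 n |` F) `\ mi0 n)%fset.
    by apply/fsubsetP => a; rewrite !inE => /and3P[-> -> _]; rewrite orbT.
  rewrite (big_fsubset _ GF) [X in _ + X]big_seq [X in _ + X]big1 ?addr0; last first.
    move=> a; rewrite !inE => /andP[aG /andP[a0]].
    rewrite (negbTE a0) /= => aF; move: aG; rewrite aF a0 /= negbK => /eqP ca.
    by rewrite /majorant ca cmod0 !mul0r.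
  apply: le_trans (_ : \sum_(a <- G) 2 * (1 - x) * B ^+ mdeg a <= _).
    rewrite big_seq [leRHS]big_seq; apply: ler_sum => a.
    rewrite !inE => /and3P[_ a0 _]; rewrite ler_wpM2r ?exprn_ge0 ?(ltW B0)//.
    by have := schur_msup_le hc a0; rewrite cE.
  rewrite -mulr_sumr ler_wpM2l ?mulr_ge0 ?subr_ge0 ?(ltW x1)//.
  apply: sum_geometric_inj; first by rewrite !inE eqxx andbF.
  move=> a b; rewrite !inE => /and3P[_ a0 ca] /and3P[_ b0 cb].
  exact: inj.
by rewrite ltNge ge1.
Qed.

End Attained.

(** * Monotonicity in the radius, and assembly of the bounds *)

Lemma bohr_property_le (R : realType) (n : nat) (r r' : R) : 0 < r -> r <= r' ->
  bohr_property (@hypercone R n) r' -> bohr_property (@hypercone R n) r.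
Proof.
move=> r0 rr'; have r'0 := lt_le_trans r0 rr'.
move=> /(bohr_propertyP _ r'0) h; apply/(bohr_propertyP _ r0) => c /h.
apply: le_lt_trans; apply: le_esum => a _; rewrite lee_fin.
rewrite ler_wpM2l ?mulr_ge0 ?cmod_ge0 ?msup_ge0//.
by rewrite lerXn2r ?nnegrE// ltW.
Qed.

Theorem mainTheorem3 (R : realType) (n : nat) (hn : (2 <= n)%N) :
  exists B : R,
    is_bohr_radius (@hypercone R n) B /\
    1 - (2 / 3) `^ n%:R^-1 < B < (446 * 10 ^+ 3 + 663) / 10 ^+ 6 / n%:R.
Proof.
have n0 : (0 < n)%N := ltnW hn.
have nR : (0 : R) < n%:R by rewrite ltr0n.
have [r1 [r1_gt0 r1_gt r1_bohr]] := bohr_lower R hn.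
pose S := [set r : R | 0 < r /\ bohr_property (@hypercone R n) r].
(* One unit below the stated constant in the last digit: the supremum only satisfies [B <= u], and
   the strict upper bound follows from this gap. *)
pose u : R := (446 * 10 ^+ 3 + 662) / 10 ^+ 6 / n%:R.
have ubS : ubound S u by move=> r [r0 hr]; apply: ltW; exact: bohr_upper.
have supS : has_sup S by split; [exists r1|exists u].
pose B := sup S.
have r1B : r1 <= B by apply: ub_le_sup; [exists u|].
have Bu : B <= u by apply: ge_sup => //; exists r1.
have B0 : 0 < B := lt_le_trans r1_gt0 r1B.
(* From [n >= 2], which gives [u <= 0.446662 / 2]. *)
have B3 : B < 1 / 3.
  apply: le_lt_trans Bu _; rewrite /u ltr_pdivrMr//.
  have : (2 : R) <= n%:R by rewrite (ler_nat R 2).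
  by lra.
have hB : bohr_property (@hypercone R n) B.
  apply: bohr_attained B0 B3 _ => r r0 rB.
  have e0 : 0 < B - r by rewrite subr_gt0.
  (* Some admissible radius lies above [r], and admissibility passes to smaller radii. *)
  have [r' [r'0 hr'] rr'] := sup_adherent e0 supS.
  by apply: bohr_property_le r0 _ hr'; move: rr'; rewrite -/B subKr; exact: ltW.
exists B; split; first by split=> // r [r0 hr]; apply: ub_le_sup; [exists u|].
rewrite (lt_le_trans r1_gt r1B) (le_lt_trans Bu)// /u ltr_pM2r ?invr_gt0//.
by lra.
Qed.
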